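(* Let $f\colon(\{0,1\}^n,\mu_p)\to\{0,1\}$ be intersecting and assume $1/\sqrt{m(f)}\le p\le1/2$. Then $\mu_p(f)\le32\exp(-0.0001/p)$.
   Context: $\mu_p$ is the $p$-biased product measure on $\{0,1\}^n$ and $\mu_p(f)=\mathbb{E}_{\mu_p}[f]$. Subsets of $[n]$ are identified with points of $\{0,1\}^n$; $f$ is intersecting if $A\cap B\ne\emptyset$ whenever $f(A)=f(B)=1$. With $\chi_i(x)=\frac{x_i-p}{\sqrt{p(1-p)}}$, $\hat f(\{i\})=\mathbb{E}_{\mu_p}[f\chi_i]$; $\delta=\max_i|\hat f(\{i\})|$ and $m(f)=|\{i:\hat f(\{i\})^2\ge\delta^2/2\}|$. *)

(* Defs.v *)
From HB Require Import structures.
From mathcomp Require Import all_boot all_order all_algebra.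
From mathcomp Require Import reals.
From mathcomp Require Import sequences exp.
Set Implicit Arguments. Unset Strict Implicit. Unset Printing Implicit Defensive.
Import Order.TTheory GRing.Theory Num.Theory.
Local Open Scope ring_scope.

(* Points of {0,1}^n are identified with subsets of [n] = 'I_n. *)

Definition mu_pt (R : realType) (n : nat) (p : R) (A : {set 'I_n}) : R :=
  p ^+ #|A| * (1 - p) ^+ (n - #|A|).

Definition mu_p (R : realType) (n : nat) (p : R) (f : {set 'I_n} -> bool) : R :=
  \sum_(A : {set 'I_n}) mu_pt p A * (f A)%:R.

Definition intersecting (n : nat) (f : {set 'I_n} -> bool) : Prop :=
  forall A B : {set 'I_n}, f A -> f B -> A :&: B != set0.

Definition chi (R : realType) (n : nat) (p : R) (i : 'I_n) (A : {set 'I_n}) : R :=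
  ((i \in A)%:R - p) / Num.sqrt (p * (1 - p)).

Definition fhat1 (R : realType) (n : nat) (p : R) (f : {set 'I_n} -> bool)
  (i : 'I_n) : R :=
  \sum_(A : {set 'I_n}) mu_pt p A * ((f A)%:R * chi p i A).

Definition delta (R : realType) (n : nat) (p : R) (f : {set 'I_n} -> bool) : R :=
  \big[Num.max/0]_(i < n) `|fhat1 p f i|.

Definition mf (R : realType) (n : nat) (p : R) (f : {set 'I_n} -> bool) : nat :=
  #|[set i : 'I_n | delta p f ^+ 2 / 2 <= fhat1 p f i ^+ 2]|.

(* Main.v *)
Require Import Defs.
From HB Require Import structures.
From mathcomp Require Import all_boot all_order all_algebra.
From mathcomp Require Import reals.
From mathcomp Require Import sequences exp.
From mathcomp Require Import ring lra zify.
Import Order.TTheory GRing.Theory Num.Theory.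
Local Open Scope ring_scope.

(* Suppose mu = mu_p(f) > 32 exp(-L) with L = 0.0001/p.

   Testing f against the signed sum of the x_i - p over the m(f) >= 1/p^2
   coordinates with large coefficient, and bounding its exponential moment,
   gives sqrt(p(1-p)) delta <= 2 p mu: every coordinate lies in a random member
   of f with probability at most 3p.

   Let S0 maximise 2^-|S| mu_p(f_{S -> 1}). The restriction to S0 is "global"
   (fixing further elements T to 1 multiplies the measure by at most 2^|T|), and
   |S0| <= 2L. Since 2L * 3p is small, at least half of f avoids S0; let S1 be the
   corresponding maximiser for that half. Restricting f to S0 and avoiding S1, and
   the half to S1, gives two cross-intersecting global families g0, g1 of measure
   at least exp(-L).

   This is impossible. Two members of a coupling that never intersects are
   correlated by the noise operator with parameter -q, q = p/(1-p), so
   sum_T (-q)^|T| g0^(T) g1^(T) = 0. But a global family of measure gamma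
   has weight at most 16 gamma^2 (64 s)^k on level k, where s is about L; as
   q * 64 s is small, the empty set dominates the sum. The level bound follows by
   induction from hypercontractivity in L^2s with a correction term for each
   restriction, the restrictions being controlled by globalness. *)

(** * Sums over subsets and the product measure *)

Section SetSums.
Variables (R : realType) (I : finType).
Implicit Types (A J T : {set I}) (F : {set I} -> R).

Lemma sum_setU1 (i : I) (P : pred {set I}) F :
  \sum_(A : {set I} | P A) F A = \sum_(A : {set I} | (i \notin A) && P A) F A
    + \sum_(A : {set I} | (i \notin A) && P (i |: A)) F (i |: A).
Proof.
rewrite (bigID (fun A : {set I} => i \notin A)) /=; congr (_ + _).
  by apply: eq_bigl => A; rewrite andbC.
rewrite (reindex_onto (fun A : {set I} => i |: A) (fun A : {set I} => A :\ i)) /=; last first.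
  by move=> A /andP[_ /negPn iA]; rewrite setD1K.
apply: eq_bigl => A; rewrite setU11 andbT andbC; congr (_ && _).
apply/eqP/idP => [<-|iA]; first by rewrite setD11.
by rewrite setU1K.
Qed.

Lemma subsetU1_notin (i : I) (S T : {set I}) :
  i \notin S -> (S \subset i |: T) = (S \subset T).
Proof.
move=> iS; apply/idP/idP => [/subsetP ST|ST].
  apply/subsetP => j jS; have := ST j jS; rewrite !inE => /predU1P[ji|//].
  by rewrite -ji jS in iS.
exact: subset_trans ST (subsetUr _ _).
Qed.

Lemma sum_subsetU1 (i : I) J F : i \notin J ->
  \sum_(T : {set I} | T \subset i |: J) F T =
  \sum_(T : {set I} | T \subset J) F T + \sum_(T : {set I} | T \subset J) F (i |: T).
Proof.
move=> iJ; rewrite (sum_setU1 i); congr (_ + _); apply: eq_bigl => T.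
  apply/andP/idP => [[iT /subsetP TJ]|TJ].
    apply/subsetP => j jT; have := TJ j jT; rewrite !inE => /predU1P[ji|//].
    by rewrite -ji jT in iT.
  split; first by apply: contra iJ; apply/subsetP.
  by apply: subset_trans TJ _; apply: subsetUr.
apply/andP/idP => [[iT /subsetP TJ]|TJ].
  apply/subsetP => j jT; have := TJ j; rewrite !inE jT orbT => /(_ isT).
  by move=> /predU1P[ji|//]; rewrite -ji jT in iT.
split; first by apply: contra iJ; apply/subsetP.
by apply: setUS.
Qed.

Lemma sum_disjoint_setU (S : {set I}) F :
  \sum_(T : {set I} | [disjoint S & T]) F (S :|: T) =
  \sum_(T : {set I} | S \subset T) F T.
Proof.
rewrite [RHS](reindex_onto (fun T : {set I} => S :|: T) (fun T : {set I} => T :\: S)) /=.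
  apply: eq_bigl => T; rewrite subsetUl /= setDUl setDv set0U.
  by rewrite disjoint_sym; apply/idP/eqP => /setDidPl.
by move=> T ST; rewrite -{1}(setIidPr ST) setID.
Qed.

Lemma sum_subset_indicator (T : {set I}) :
  \sum_(S : {set I}) (S \subset T)%:R = 2 ^+ #|T| :> R.
Proof.
rewrite -natrX -card_powerset -sum1_card natr_sum [RHS]big_mkcond /=.
by apply: eq_bigr => S _; rewrite inE; case: (S \subset T).
Qed.

End SetSums.

Section Expectation.
Variables (R : realType) (n : nat) (p : R).
Implicit Types (A B S T X : {set 'I_n}) (g h : {set 'I_n} -> R).

Definition expect g : R := \sum_A mu_pt p A * g A.

Lemma mu_pt_prod A : mu_pt p A = \prod_i (if i \in A then p else 1 - p).
Proof.
rewrite (bigID (mem A)) /= (eq_bigr (fun=> p)); last by move=> i ->.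
rewrite [X in _ * X](eq_bigr (fun=> 1 - p)); last by move=> i /negPf ->.
rewrite !prodr_const /mu_pt; congr (_ * _ ^+ _).
have E : (#|A| + #|[predC mem A]|)%N = n by rewrite cardC card_ord.
have le_An : (#|A| <= n)%N by rewrite -[X in (_ <= X)%N]E leq_addr.
by apply/eqP; rewrite -(eqn_add2l #|A|) subnKC // E.
Qed.

Lemma expect_prod (F : 'I_n -> bool -> R) :
  expect (fun A => \prod_i F i (i \in A)) =
  \prod_i (p * F i true + (1 - p) * F i false).
Proof.
rewrite bigA_distr; apply: eq_bigr => A _.
rewrite mu_pt_prod -big_split /=; apply: eq_bigr => i _.
by case: (i \in A).
Qed.

Lemma eq_expect g h : g =1 h -> expect g = expect h.
Proof. by move=> gh; apply: eq_bigr => A _; rewrite gh. Qed.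

Lemma expectZ (c : R) g : expect (fun A => c * g A) = c * expect g.
Proof. by rewrite /expect mulr_sumr; apply: eq_bigr => A _; rewrite mulrCA. Qed.

Lemma expectD g h : expect (fun A => g A + h A) = expect g + expect h.
Proof. by rewrite /expect -big_split; apply: eq_bigr => A _; rewrite mulrDr. Qed.

Lemma expect_sum (J : finType) (P : pred J) (g : J -> {set 'I_n} -> R) :
  expect (fun A => \sum_(j | P j) g j A) = \sum_(j | P j) expect (g j).
Proof.
by rewrite /expect exchange_big; apply: eq_bigr => A _; rewrite mulr_sumr.
Qed.

Lemma expect1 : expect (fun=> 1) = 1.
Proof.
have := expect_prod (fun _ _ => 1); rewrite !big1_eq /= => ->.
by rewrite big1 // => i _; rewrite !mulr1 addrC subrK.
Qed.

Lemma expect_cst (c : R) : expect (fun=> c) = c.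
Proof.
by rewrite -[RHS]mulr1 -expect1 -expectZ; apply: eq_expect => A; rewrite mulr1.
Qed.

Lemma expect_resample (i : 'I_n) g :
  expect g = expect (fun A => p * g (i |: A) + (1 - p) * g (A :\ i)).
Proof.
pose w A := \prod_(j | j != i) (if j \in A then p else 1 - p).
have muE A : mu_pt p A = (if i \in A then p else 1 - p) * w A.
  by rewrite mu_pt_prod (bigD1 i).
have wU A : w (i |: A) = w A.
  by apply: eq_bigr => j /negPf ji; rewrite !inE ji.
rewrite /expect (sum_setU1 _ _ i) [RHS](sum_setU1 _ _ i) -!big_split /=.
apply: eq_bigr => A; rewrite andbT => iA.
have iAD : A :\ i = A.
  by apply/setP => j; rewrite !inE; case: eqVneq => [->|//]; rewrite (negPf iA).
rewrite !muE setU11 (negPf iA) wU setUA setUid setU1K // iAD.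
ring.
Qed.

(** Invariance under adding [i] already says that [g] ignores coordinate [i], because
    [i |: (A :\ i) = i |: A]. The factor [phi] is then independent of [g]. *)
Lemma expect_factor (i : 'I_n) (phi : bool -> R) g :
  (forall A, g (i |: A) = g A) ->
  expect (fun A => phi (i \in A) * g A) =
  (p * phi true + (1 - p) * phi false) * expect g.
Proof.
move=> gi; rewrite (expect_resample i) -expectZ; apply: eq_expect => A.
have gD : g (A :\ i) = g A.
  rewrite -gi -[RHS]gi; congr (g _).
  by apply/setP => j; rewrite !inE; case: (j == i).
by rewrite setU11 setD11 gi gD; ring.
Qed.

Lemma expect_prod_factor S (phi : 'I_n -> bool -> R) g :
  (forall i A, i \in S -> g (i |: A) = g A) ->
  expect (fun A => (\prod_(i in S) phi i (i \in A)) * g A) =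
  (\prod_(i in S) (p * phi i true + (1 - p) * phi i false)) * expect g.
Proof.
have [k] := ubnP #|S|; elim: k S g => // k IH S g /ltnSE leSk gS.
have [->|[i iS]] := set_0Vmem S.
  by rewrite big_set0 mul1r; apply: eq_expect => A; rewrite big_set0 mul1r.
rewrite (big_setD1 i) //= -mulrA -IH; first last.
- by move=> j A /setD1P[_ jS]; apply: gS.
- by move: leSk; rewrite (cardsD1 i) iS.
rewrite -(expect_factor i (phi i)) => [|A].
  by apply: eq_expect => A; rewrite [in LHS](big_setD1 i) //= mulrA.
rewrite gS //; congr (_ * _); apply: eq_bigr => j /setD1P[ji _].
by rewrite !inE (negPf ji).
Qed.

Hypotheses (p_ge0 : 0 <= p) (p_le1 : p <= 1).

Lemma mu_pt_ge0 A : 0 <= mu_pt p A.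
Proof. by rewrite mulr_ge0 ?exprn_ge0 // subr_ge0. Qed.

Lemma le_expect g h : (forall A, g A <= h A) -> expect g <= expect h.
Proof. by move=> gh; apply: ler_sum => A _; rewrite ler_wpM2l ?mu_pt_ge0. Qed.

Lemma expect_ge0 g : (forall A, 0 <= g A) -> 0 <= expect g.
Proof. by move=> g0; apply: sumr_ge0 => A _; rewrite mulr_ge0 ?mu_pt_ge0. Qed.

End Expectation.

Arguments expect {R n} p g.

(** * The two-point inequality *)

Lemma cauchy_schwarz_sum (R : realType) (V : finType) (a b : V -> R) :
  (\sum_v a v * b v) ^+ 2 <= (\sum_v a v ^+ 2) * (\sum_v b v ^+ 2).
Proof.
have expand (x y : R) : \sum_v (x * a v - y * b v) ^+ 2 =
    x ^+ 2 * (\sum_v a v ^+ 2) - 2 * x * y * (\sum_v a v * b v)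
      + y ^+ 2 * (\sum_v b v ^+ 2).
  rewrite !mulr_sumr -sumrB -big_split /=; apply: eq_bigr => v _; ring.
set A := \sum_v a v ^+ 2; set B := \sum_v b v ^+ 2; set P := \sum_v _.
have B0 : 0 <= B by apply: sumr_ge0 => v _; apply: sqr_ge0.
have [BE|Bn] := eqVneq B 0.
  have b0 v : b v = 0.
    apply/eqP; rewrite -sqrf_eq0; apply/eqP.
    by apply: (psumr_eq0P _ BE) => // w _; apply: sqr_ge0.
  by rewrite /P big1 ?expr0n ?BE ?mulr0 // => v _; rewrite b0 mulr0.
have : 0 <= \sum_v (B * a v - P * b v) ^+ 2 by apply: sumr_ge0 => v _; apply: sqr_ge0.
have -> : \sum_v (B * a v - P * b v) ^+ 2 = B ^+ 2 * A - 2 * B * P * P + P ^+ 2 * B.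
  exact: expand.
have -> : B ^+ 2 * A - 2 * B * P * P + P ^+ 2 * B = B * (A * B - P ^+ 2) by ring.
by rewrite pmulr_rge0 ?subr_ge0 // lt0r Bn.
Qed.

Section TwoPoint.
Variable R : realType.
Implicit Types (x y z : R).

(** Multiply by [1 - z > 0]: the left side becomes at most 1 since [1 - z <= expR (- z)], and the
    right side becomes [1 + z^2 (1 - 2z) >= 1]. *)
Lemma expR_le_quadratic z : z <= 1 / 2 -> expR z <= 1 + z + 2 * z ^+ 2.
Proof.
move=> z_le; have z1 : 0 < 1 - z by lra.
have ez : expR z * (1 - z) <= 1.
  apply: le_trans (ler_wpM2l (expR_ge0 z) (expR_ge1Dx (- z))) _.
  by rewrite expRxMexpNx_1.
rewrite -(ler_pM2r z1); apply: le_trans ez _.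
have -> : (1 + z + 2 * z ^+ 2) * (1 - z) = 1 + z ^+ 2 * (1 - 2 * z) by ring.
by rewrite lerDl mulr_ge0 ?sqr_ge0 //; lra.
Qed.

Lemma exprD1_le_quadratic (s : nat) y : -1 <= y -> s%:R * y <= 1 / 2 ->
  (1 + y) ^+ s <= 1 + s%:R * y + 2 * (s%:R * y) ^+ 2.
Proof.
move=> y_ge sy; apply: le_trans (expR_le_quadratic _ sy).
rewrite expRM_natl lerXn2r ?nnegrE ?expR_ge0 ?expR_ge1Dx //; lra.
Qed.

Lemma sqr_le_bound x y : 0 <= x -> y ^+ 2 <= x ^+ 2 -> - x <= y <= x.
Proof.
move=> x0 yx; rewrite -ler_norml -(ler_pXn2r (ltn0Sn 1)) ?nnegrE //.
by rewrite real_normK ?num_real.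
Qed.

(** Here [a] and [b] stand for squared norms of two vectors and [v] for their inner product. The
    form is the squared norm of the first plus [e] times the second, and Cauchy-Schwarz is all that
    is retained of the vectors. *)
Lemma qform_ge0 (e a b v : R) : 0 <= a -> 0 <= b -> v ^+ 2 <= a * b ->
  0 <= a + 2 * e * v + e ^+ 2 * b.
Proof.
move=> a0 b0 vab; have eb0 : 0 <= e ^+ 2 * b by rewrite mulr_ge0 ?sqr_ge0.
suff /andP[] : - (a + e ^+ 2 * b) <= 2 * e * v <= a + e ^+ 2 * b by lra.
apply: sqr_le_bound; first by rewrite addr_ge0.
have : 4 * e ^+ 2 * v ^+ 2 <= 4 * e ^+ 2 * (a * b).
  by rewrite ler_wpM2l // mulr_ge0 // sqr_ge0.
have := sqr_ge0 (a - e ^+ 2 * b); lra.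
Qed.

Lemma bernoulli_le (s : nat) y : 0 <= y -> 1 + s%:R * y <= (1 + y) ^+ s.
Proof.
move=> y0; elim: s => [|s IH]; first by rewrite mul0r addr0 expr0.
rewrite exprS -natr1; have s0 : 0 <= s%:R * y by rewrite mulr_ge0 ?ler0n.
have : (1 + y) * (1 + s%:R * y) <= (1 + y) * (1 + y) ^+ s.
  by rewrite ler_wpM2l //; lra.
by apply: le_trans; have := mulr_ge0 y0 s0; nra.
Qed.

(** The case of mean 1 and small increments. Each [s]-th power is expanded to second order; the
    terms linear in [v] cancel because the character has mean zero ([p * x1 = (1 - p) * x0]), and
    the rest is [(s + 17 s^2) rho^2 b <= s b]. This is why [rho^2 = 1 / (18 s)]. Bernoulli's
    inequality finishes. *)
Lemma two_point_small (s : nat) (p rho x1 x0 b v : R) :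
  (0 < s)%N -> 0 <= p -> p <= 1 -> 0 <= x0 -> x0 <= x1 ->
  p * x1 = (1 - p) * x0 -> p * x1 ^+ 2 + (1 - p) * x0 ^+ 2 = 1 ->
  0 <= rho -> rho ^+ 2 * (18 * s%:R) = 1 -> v ^+ 2 <= b ->
  (rho * x1) ^+ 2 * b * (25 * s%:R ^+ 2) <= 1 ->
  p * (1 + 2 * (rho * x1) * v + (rho * x1) ^+ 2 * b) ^+ s
   + (1 - p) * (1 - 2 * (rho * x0) * v + (rho * x0) ^+ 2 * b) ^+ s
  <= (1 + b) ^+ s.
Proof.
move=> s_gt0 p0 p1 x0_ge0 x01 px E2 rho0 rhoE vb small.
have s1 : 1 <= s%:R :> R by rewrite ler1n.
have b0 : 0 <= b by apply: le_trans vb; rewrite sqr_ge0.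
set e := rho * x1 in small *; set d := rho * x0.
have d0 : 0 <= d by rewrite mulr_ge0.
have de : d <= e by rewrite ler_wpM2l.
have e0 : 0 <= e by apply: le_trans de.
have key (w : R) (u : R) : 0 <= u -> u <= e -> w ^+ 2 <= b ->
    (1 + 2 * u * w + u ^+ 2 * b) ^+ s <=
    1 + s%:R * (2 * u * w + u ^+ 2 * b) + 17 * s%:R ^+ 2 * (u ^+ 2 * b).
  move=> u0 ue wb.
  have ub : u ^+ 2 * b * (25 * s%:R ^+ 2) <= 1.
    apply: le_trans small; rewrite ler_wpM2r ?ler_wpM2r //.
      by rewrite mulr_ge0 ?sqr_ge0.
    by rewrite lerXn2r.
  have t0 : 0 <= u ^+ 2 * b by rewrite mulr_ge0 ?sqr_ge0.
  have uw2 : (u * w) ^+ 2 <= u ^+ 2 * b.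
    by rewrite exprMn ler_wpM2l ?sqr_ge0.
  set t := u ^+ 2 * b in ub t0 uw2 *.
  have uw : s%:R * (u * w) <= 1 / 5.
    have : (s%:R * (u * w)) ^+ 2 <= (1 / 5) ^+ 2.
      by rewrite exprMn; have := ler_wpM2l (sqr_ge0 (s%:R : R)) uw2; nra.
    have [h|h] := lerP (s%:R * (u * w)) 0; first by move=> _; lra.
    by rewrite ler_pXn2r ?nnegrE // ?ltW //; lra.
  have st : s%:R * t <= 1 / 25.
    have : s%:R * t <= s%:R ^+ 2 * t.
      by rewrite expr2 -mulrA ler_peMl // mulr_ge0 // (le_trans ler01).
    lra.
  have t25 : t <= 1 / 25.
    by apply: le_trans st; rewrite ler_peMl.
  rewrite -addrA.
  have y1 : -1 <= 2 * u * w + t.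
    have := sqr_ge0 (1 + u * w); nra.
  have y2 : s%:R * (2 * u * w + t) <= 1 / 2.
    have -> : s%:R * (2 * u * w + t) = 2 * (s%:R * (u * w)) + s%:R * t by ring.
    lra.
  apply: le_trans (exprD1_le_quadratic _ _ y1 y2) _.
  rewrite lerD2l.
  have -> : 2 * (s%:R * (2 * u * w + t)) ^+ 2 =
            2 * s%:R ^+ 2 * (2 * (u * w) + t) ^+ 2 by ring.
  have -> : 17 * s%:R ^+ 2 * t = 2 * s%:R ^+ 2 * (17 / 2 * t) :> R by field.
  rewrite ler_wpM2l ?mulr_ge0 ?sqr_ge0 //.
  have := sqr_ge0 (2 * (u * w) - t); nra.
have vb' : (- v) ^+ 2 <= b by rewrite sqrrN.
have k1 := key v e e0 (lexx _) vb.
have k0 := key (- v) d d0 de vb'.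
rewrite mulrN in k0.
apply: le_trans (lerD (ler_wpM2l p0 k1) (ler_wpM2l _ k0)) _; first by lra.
have edE : p * e ^+ 2 + (1 - p) * d ^+ 2 = rho ^+ 2.
  transitivity (rho ^+ 2 * (p * x1 ^+ 2 + (1 - p) * x0 ^+ 2)).
    by rewrite /e /d; ring.
  by rewrite E2 mulr1.
have ped : p * e = (1 - p) * d.
  by rewrite /e /d mulrCA px; ring.
have -> : p * (1 + s%:R * (2 * e * v + e ^+ 2 * b) + 17 * s%:R ^+ 2 * (e ^+ 2 * b))
  + (1 - p) * (1 + s%:R * (- (2 * d * v) + d ^+ 2 * b)
     + 17 * s%:R ^+ 2 * (d ^+ 2 * b))
  = 1 + 2 * s%:R * v * (p * e - (1 - p) * d)
    + (s%:R + 17 * s%:R ^+ 2) * b * (p * e ^+ 2 + (1 - p) * d ^+ 2) by ring.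
rewrite edE ped subrr mulr0 addr0.
apply: le_trans (bernoulli_le s b b0).
have h : (s%:R + 17 * s%:R ^+ 2) * rho ^+ 2 <= s%:R.
  have := sqr_ge0 rho; nra.
by rewrite lerD2l mulrAC ler_wpM2r.
Qed.

(* The last term pays for the case where the increment on the rare value
   dominates the mean; without it the inequality fails for small [p]. *)
Lemma two_point (s : nat) (p rho x1 x0 a b v : R) :
  (0 < s)%N -> 0 < p -> p <= 1 -> 0 <= x0 -> x0 <= 1 -> x0 * x1 = 1 ->
  p * x1 = (1 - p) * x0 -> p * x1 ^+ 2 + (1 - p) * x0 ^+ 2 = 1 ->
  0 <= rho -> rho ^+ 2 * (18 * s%:R) = 1 ->
  0 <= a -> 0 <= b -> v ^+ 2 <= a * b ->
  p * (a + 2 * (rho * x1) * v + (rho * x1) ^+ 2 * b) ^+ s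
   + (1 - p) * (a - 2 * (rho * x0) * v + (rho * x0) ^+ 2 * b) ^+ s
  <= (a + b) ^+ s + p * (x1 ^+ 2 * (2 * s%:R)) ^+ s * b ^+ s.
Proof.
move=> s_gt0 p0 p1 x0_ge0 x0_le1 x01 px E2 rho0 rhoE a0 b0 vab.
have s1 : 1 <= s%:R :> R by rewrite ler1n.
have x1_ge1 : 1 <= x1.
  have x0n : x0 != 0.
    by apply/eqP => x00; move: x01; rewrite x00 mul0r => /eqP; rewrite eq_sym oner_eq0.
  have x0p : 0 < x0 by rewrite lt0r x0n.
  by rewrite -(ler_pM2l x0p) mulr1 x01.
have M0 : 0 <= p * (x1 ^+ 2 * (2 * s%:R)) ^+ s * b ^+ s.
  rewrite !mulr_ge0 ?exprn_ge0 ?(ltW p0) // !mulr_ge0 ?sqr_ge0 //; lra.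
have x1_ge0 : 0 <= x1 by apply: le_trans x1_ge1.
set e := rho * x1; set d := rho * x0.
have e0 : 0 <= e by rewrite mulr_ge0.
have d0 : 0 <= d by rewrite mulr_ge0.
have edE : e * d = rho ^+ 2 by rewrite /e /d mulrACA -expr2 [x1 * _]mulrC x01 mulr1.
(* If [a <= 25 s^2 e^2 b], the rare value is at most [(25 s^2 + 10 s + 1) e^2 b <= 36 s^2 e^2 b = 2
   s x1^2 b], which the extra term pays for, while [e * d = rho^2] keeps the common value below
   [a + b]. *)
have [le_ae|lt_ea] := lerP a (e ^+ 2 * b * (25 * s%:R ^+ 2)).
  have v_le : - (e * b * (5 * s%:R)) <= v <= e * b * (5 * s%:R).
    apply: sqr_le_bound; first by rewrite !mulr_ge0.
    apply: (le_trans vab); apply: le_trans (ler_wpM2r b0 le_ae) _.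
    by rewrite le_eqVlt; apply/orP; left; apply/eqP; ring.
  case/andP: v_le => v_ge v_le.
  have d_le : - (2 * d * v) <= 10 * s%:R * rho ^+ 2 * b.
    have -> : - (2 * d * v) = 2 * d * - v by ring.
    have -> : 10 * s%:R * rho ^+ 2 * b = 2 * d * (e * b * (5 * s%:R)).
      by rewrite -edE; ring.
    rewrite ler_wpM2l //; first by rewrite mulr_ge0.
    by rewrite lerNl.
  have d2_le : d ^+ 2 * b <= rho ^+ 2 * b.
    by rewrite ler_wpM2r // exprMn ler_piMr ?sqr_ge0 // exprn_ile1.
  have rho_le : rho ^+ 2 * b <= s%:R * rho ^+ 2 * b.
    by rewrite -mulrA ler_peMl // mulr_ge0 ?sqr_ge0.
  have srho : s%:R * rho ^+ 2 * b = b / 18.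
    have -> : s%:R * rho ^+ 2 * b = (rho ^+ 2 * (18 * s%:R)) * b / 18 by field.
    by rewrite rhoE mul1r.
  have e2 : e ^+ 2 * (36 * s%:R ^+ 2) = x1 ^+ 2 * (2 * s%:R).
    transitivity (x1 ^+ 2 * (2 * s%:R) * (rho ^+ 2 * (18 * s%:R))).
      by rewrite /e; ring.
    by rewrite rhoE mulr1.
  have b1 : a + 2 * e * v + e ^+ 2 * b <= x1 ^+ 2 * (2 * s%:R) * b.
    have v_le' : 2 * e * v <= e ^+ 2 * b * (10 * s%:R).
      have -> : e ^+ 2 * b * (10 * s%:R) = 2 * e * (e * b * (5 * s%:R)) by ring.
      by rewrite ler_wpM2l ?mulr_ge0.
    rewrite -e2.
    have : e ^+ 2 * b * (25 * s%:R ^+ 2 + 10 * s%:R + 1) <=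
           e ^+ 2 * b * (36 * s%:R ^+ 2).
      by rewrite ler_wpM2l ?mulr_ge0 ?sqr_ge0 //; nra.
    lra.
  rewrite addrC; apply: lerD.
    have h : (a - 2 * d * v + d ^+ 2 * b) ^+ s <= (a + b) ^+ s.
      have := qform_ge0 d a b (- v) a0 b0; rewrite sqrrN mulrN => /(_ vab) nn.
      by rewrite lerXn2r ?nnegrE //; lra.
    apply: le_trans (ler_wpM2l _ h) _; first by lra.
    by rewrite ler_piMl ?exprn_ge0 ?addr_ge0 //; lra.
  rewrite -[X in _ <= X]mulrA ler_wpM2l ?(ltW p0) // -exprMn lerXn2r ?nnegrE //.
    exact: qform_ge0.
  by rewrite !mulr_ge0 ?sqr_ge0 //; lra.
(* In the other case [a] is positive, and homogeneity of degree [s] in [(a, b, v)] reduces to mean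
   1, that is to [two_point_small]. *)
have a_gt0 : 0 < a.
  by apply: le_lt_trans lt_ea; rewrite !mulr_ge0 ?sqr_ge0.
have an : a != 0 by rewrite gt_eqF.
have := @two_point_small s p rho x1 x0 (b / a) (v / a).
rewrite -/e -/d => /(_ s_gt0 (ltW p0) p1 x0_ge0).
move=> /(_ (le_trans x0_le1 x1_ge1) px E2 rho0 rhoE).
have -> : e ^+ 2 * (b / a) * (25 * s%:R ^+ 2) = e ^+ 2 * b * (25 * s%:R ^+ 2) / a.
  by field.
rewrite ler_pdivrMr // mul1r expr_div_n ler_pdivrMr ?exprn_gt0 //.
have -> : b / a * a ^+ 2 = a * b by field.
move=> /(_ vab (ltW lt_ea)) h.
apply: (@le_trans _ _ ((a + b) ^+ s)); last by rewrite lerDl.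
have E1 : (a + b) = a * (1 + b / a) by field.
have E3 : a + 2 * e * v + e ^+ 2 * b =
          a * (1 + 2 * e * (v / a) + e ^+ 2 * (b / a)) by field.
have E4 : a - 2 * d * v + d ^+ 2 * b =
          a * (1 - 2 * d * (v / a) + d ^+ 2 * (b / a)) by field.
rewrite E1 E3 E4 ![(a * _) ^+ s]exprMn ![_ * (a ^+ s * _)]mulrCA -mulrDr.
by rewrite ler_wpM2l // exprn_ge0.
Qed.

End TwoPoint.

(** * Hypercontractivity on the biased cube *)

Definition chiS {R : realType} {n : nat} (p : R) (T A : {set 'I_n}) : R :=
  \prod_(i in T) chi p i A.

Section Characters.
Variables (R : realType) (n : nat) (p : R).
Hypotheses (p_gt0 : 0 < p) (p_lt1 : p < 1).
Implicit Types (A S T : {set 'I_n}) (i : 'I_n).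

Let sg := Num.sqrt (p * (1 - p)).

Lemma sqrt_pq_gt0 : 0 < Num.sqrt (p * (1 - p)).
Proof. by rewrite sqrtr_gt0 mulr_gt0 ?subr_gt0. Qed.

Lemma sqr_sqrt_pq : Num.sqrt (p * (1 - p)) ^+ 2 = p * (1 - p).
Proof. by rewrite sqr_sqrtr // mulr_ge0 ?(ltW p_gt0) // subr_ge0 ltW. Qed.

Lemma chiE i A : chi p i A = if i \in A then (1 - p) / sg else - (p / sg).
Proof. by rewrite /chi; case: (i \in A); rewrite ?sub0r ?mulNr. Qed.

Lemma chiS0 A : chiS p set0 A = 1.
Proof. by rewrite /chiS big_set0. Qed.

Lemma chiSU1 i T A : i \notin T -> chiS p (i |: T) A = chi p i A * chiS p T A.
Proof. by move=> iT; rewrite /chiS big_setU1. Qed.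

Lemma chiS_setU S T A : [disjoint S & T] -> chiS p (S :|: T) A = chiS p S A * chiS p T A.
Proof.
move=> ST; rewrite /chiS -bigU //; apply: eq_bigl => i.
by rewrite !inE.
Qed.

Lemma chiS_addl i T A : i \notin T -> chiS p T (i |: A) = chiS p T A.
Proof.
move=> iT; apply: eq_bigr => j jT; rewrite !chiE !inE.
by case: eqVneq jT => // ->; rewrite (negPf iT).
Qed.

Lemma chiS_del i T A : i \notin T -> chiS p T (A :\ i) = chiS p T A.
Proof.
move=> iT; apply: eq_bigr => j jT; rewrite !chiE !inE.
by case: eqVneq jT => // ->; rewrite (negPf iT).
Qed.

Section Hypercontractivity.
Variables (s : nat) (rho : R).
Hypotheses (s_gt0 : (0 < s)%N) (rho_ge0 : 0 <= rho).
Hypotheses (rhoE : rho ^+ 2 * (18 * s%:R) = 1) (p_le_half : p <= 1 / 2).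

(** The correction factor of [two_point], since [chi] takes its large value, of square
    [(1 - p) / p], with probability [p]. It is paid once per restricted coordinate. *)
Let M := p * ((1 - p) / p * (2 * s%:R)) ^+ s.

(* Vector-valued functions absorb the coordinates already processed, so the
   induction on coordinates needs only the two-point inequality. *)
Lemma hypercontractive (J : {set 'I_n}) (V : finType)
    (c : V -> {set 'I_n} -> R) :
  expect p (fun A => (\sum_v (\sum_(T : {set 'I_n} | T \subset J)
     rho ^+ #|T| * c v T * chiS p T A) ^+ 2) ^+ s) <=
  \sum_(S : {set 'I_n} | S \subset J) M ^+ #|S| *
    (\sum_v \sum_(T : {set 'I_n} | T \subset J) (S \subset T)%:R * c v T ^+ 2) ^+ s.
Proof.
have [k] := ubnP #|J|; elim: k J V c => // k IH J V c /ltnSE leJk.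
have [->|[i iJ]] := set_0Vmem J.
  have sub0 (F : {set 'I_n} -> R) :
      \sum_(T : {set 'I_n} | T \subset set0) F T = F set0.
    by rewrite (eq_bigl (pred1 set0)) ?big_pred1_eq // => T; rewrite subset0.
  rewrite sub0 cards0 expr0 mul1r.
  rewrite -[leRHS](expect_cst _ n p) le_eqVlt; apply/orP; left; apply/eqP.
  apply: eq_expect => A; congr (_ ^+ _); apply: eq_bigr => v _.
  by rewrite !sub0 sub0set cards0 chiS0 expr0 !mul1r mulr1.
set J' := J :\ i; have iJ' : i \notin J' by rewrite setD11.
have iT (T : {set 'I_n}) : T \subset J' -> i \notin T.
  by move=> TJ; apply: contra iJ'; apply/subsetP.
have JE : J = i |: J' by rewrite setD1K.
(* The polynomial splits as [a + rho * chi_i * b] with [a] and [b] free of coordinate [i]. *)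
pose a v A := \sum_(T : {set 'I_n} | T \subset J') rho ^+ #|T| * c v T * chiS p T A.
pose b v A := \sum_(T : {set 'I_n} | T \subset J')
   rho ^+ #|T| * c v (i |: T) * chiS p T A.
have aU v A : a v (i |: A) = a v A.
  by apply: eq_bigr => T /iT iT'; rewrite chiS_addl.
have bU v A : b v (i |: A) = b v A.
  by apply: eq_bigr => T /iT iT'; rewrite chiS_addl.
have aD v A : a v (A :\ i) = a v A.
  by apply: eq_bigr => T /iT iT'; rewrite chiS_del.
have bD v A : b v (A :\ i) = b v A.
  by apply: eq_bigr => T /iT iT'; rewrite chiS_del.
have abE v A : \sum_(T : {set 'I_n} | T \subset J) rho ^+ #|T| * c v T * chiS p T A
    = a v A + rho * chi p i A * b v A.
  rewrite JE sum_subsetU1 //; congr (_ + _); rewrite mulr_sumr.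
  apply: eq_bigr => T /iT iT'; rewrite chiSU1 // cardsU1 iT' exprS; ring.
have sqE (e : R) A : \sum_v (a v A + e * b v A) ^+ 2 =
    (\sum_v a v A ^+ 2) + 2 * e * (\sum_v a v A * b v A)
      + e ^+ 2 * (\sum_v b v A ^+ 2).
  rewrite !mulr_sumr -!big_split /=; apply: eq_bigr => v _; ring.
have a2 A : 0 <= \sum_v a v A ^+ 2 by apply: sumr_ge0 => v _; apply: sqr_ge0.
have b2 A : 0 <= \sum_v b v A ^+ 2 by apply: sumr_ge0 => v _; apply: sqr_ge0.
have CS A : (\sum_v a v A * b v A) ^+ 2 <= (\sum_v a v A ^+ 2) * (\sum_v b v A ^+ 2).
  exact: cauchy_schwarz_sum.
(* The two-point inequality in coordinate [i]. The main term, the sum of the squares of all [a v]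
   and [b v], is again the squared norm of a vector-valued polynomial, indexed by [V + V]; the
   correction involves only the derivative [b]. The induction hypothesis applies to both. *)
apply: (@le_trans _ _ (expect p (fun A =>
    (\sum_(w : V + V) (\sum_(T : {set 'I_n} | T \subset J') rho ^+ #|T| *
        (match w with inl v => c v T | inr v => c v (i |: T) end) * chiS p T A) ^+ 2) ^+ s
    + M * (\sum_v (\sum_(T : {set 'I_n} | T \subset J')
        rho ^+ #|T| * c v (i |: T) * chiS p T A) ^+ 2) ^+ s))).
  rewrite (expect_resample _ _ _ i); apply: le_expect; rewrite ?(ltW p_gt0) ?(ltW p_lt1) //.
  move=> A; rewrite big_sumType /=.
  have E1 : \sum_v (\sum_(T : {set 'I_n} | T \subset J)
      rho ^+ #|T| * c v T * chiS p T (i |: A)) ^+ 2 =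
      \sum_v (a v A + (rho * ((1 - p) / sg)) * b v A) ^+ 2.
    by apply: eq_bigr => v _; rewrite abE aU bU chiE setU11.
  have E0 : \sum_v (\sum_(T : {set 'I_n} | T \subset J)
      rho ^+ #|T| * c v T * chiS p T (A :\ i)) ^+ 2 =
      \sum_v (a v A + (- (rho * (p / sg))) * b v A) ^+ 2.
    by apply: eq_bigr => v _; rewrite abE aD bD chiE setD11 mulrN.
  rewrite E1 E0 !sqE mulrN mulNr sqrrN.
  have sg0 := sqrt_pq_gt0; have sg2 := sqr_sqrt_pq; rewrite -/sg in sg0 sg2.
  have sgn : sg != 0 by rewrite gt_eqF.
  have pn : p != 0 by rewrite gt_eqF.
  have -> : M = p * (((1 - p) / sg) ^+ 2 * (2 * s%:R)) ^+ s.
    rewrite /M expr_div_n sg2; congr (_ * (_ * _) ^+ _); field.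
    by rewrite pn /= subr_eq0 gt_eqF.
  have ppq : p <= 1 - p by have := p_le_half; lra.
  apply: two_point; rewrite ?(ltW p_gt0) ?(ltW p_lt1) ?a2 ?b2 ?CS //.
  - by rewrite divr_ge0 ?ltW.
  - rewrite ler_pdivrMr // mul1r -(ler_pXn2r (ltn0Sn 1)) ?nnegrE ?(ltW p_gt0) ?(ltW sg0) // sg2.
    by rewrite expr2 ler_wpM2l ?(ltW p_gt0).
  - by rewrite mulf_div -expr2 sg2 divff // mulf_neq0 // subr_eq0 gt_eqF.
  - by rewrite mulrCA.
  - rewrite !expr_div_n sg2; field.
    by rewrite pn /= subr_eq0 gt_eqF.
rewrite expectD expectZ [leRHS](_ : _ =
   (\sum_(S : {set 'I_n} | S \subset J') M ^+ #|S| *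
    (\sum_(w : V + V) \sum_(T : {set 'I_n} | T \subset J') (S \subset T)%:R *
      (match w with inl v => c v T | inr v => c v (i |: T) end) ^+ 2) ^+ s) +
   M * \sum_(S : {set 'I_n} | S \subset J') M ^+ #|S| *
    (\sum_v \sum_(T : {set 'I_n} | T \subset J') (S \subset T)%:R
       * c v (i |: T) ^+ 2) ^+ s).
  have M0 : 0 <= M.
    rewrite mulr_ge0 ?exprn_ge0 ?(ltW p_gt0) // mulr_ge0 ?mulr_ge0 //.
    - by rewrite subr_ge0 ltW.
    - by rewrite invr_ge0 ltW.
  have ltJ' : (#|J'| < k)%N by move: leJk; rewrite (cardsD1 i) iJ.
  apply: lerD; first exact: IH.
  by rewrite ler_wpM2l // IH.
(* Sets [S] without [i] come from the main term; those containing [i] come from the correction term,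
   with one more factor [M]. *)
rewrite JE sum_subsetU1 //; congr (_ + _).
  apply: eq_bigr => S SJ; congr (_ * _ ^+ s).
  rewrite big_sumType /= -big_split; apply: eq_bigr => v _.
  rewrite sum_subsetU1 //; congr (_ + _).
  by apply: eq_bigr => T TJ; rewrite subsetU1_notin ?iT.
rewrite mulr_sumr; apply: eq_bigr => S SJ; rewrite mulrA cardsU1 (iT _ SJ) exprS.
congr (_ * _ ^+ s); apply: eq_bigr => v _; rewrite sum_subsetU1 //.
rewrite big1 ?add0r => [|T TJ]; last first.
  by rewrite subUset sub1set (negPf (iT _ TJ)) mul0r.
by apply: eq_bigr => T TJ; rewrite subUset sub1set setU11 subsetU1_notin ?iT.
Qed.

End Hypercontractivity.
End Characters.

(** * Level inequality for global functions *)

Definition fhat {R : realType} {n : nat} (p : R) (f : {set 'I_n} -> R)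
  (T : {set 'I_n}) : R := expect p (fun A => f A * chiS p T A).

(* Used in place of Hölder's inequality, with [x] a normalised polynomial. *)
Lemma le_cutoff_power (R : realType) (s : nat) (x : R) : (0 < s)%N -> 0 <= x ->
  x <= 2 + 2 * ((4 ^+ s)^-1 * (x ^+ 2) ^+ s).
Proof.
move=> s0 x0; have q0 : 0 <= (4 ^+ s)^-1 * (x ^+ 2) ^+ s.
  by rewrite mulr_ge0 ?invr_ge0 ?exprn_ge0 // sqr_ge0.
have [x2|x2] := lerP x 2; first by lra.
have -> : (4 ^+ s)^-1 * (x ^+ 2) ^+ s = ((x / 2) ^+ 2) ^+ s.
  have -> : 4 = 2 ^+ 2 :> R by rewrite -natrX.
  by rewrite !expr_div_n mulrC.
have y1 : 1 <= x / 2 by lra.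
have : x / 2 <= (x / 2) ^+ 2 ^+ s.
  by rewrite -exprM ler_eXnr // muln_gt0.
lra.
Qed.

Section Level.
Variables (R : realType) (n : nat) (p : R) (s : nat) (gam : R).
Variable f : {set 'I_n} -> R.
Implicit Types (A S T X : {set 'I_n}).
Hypotheses (p_gt0 : 0 < p) (p_le_half : p <= 1 / 2).
Hypotheses (f_ge0 : forall A, 0 <= f A) (f_le1 : forall A, f A <= 1).
Hypothesis f_global : forall X,
  expect p (fun A => f A * (X \subset A)%:R) <= (2 * p) ^+ #|X| * gam.
Hypotheses (s_ge4 : (4 <= s)%N) (gam_ge : 1 <= 4 ^+ s * gam).

Let sg := Num.sqrt (p * (1 - p)).

Let p_lt1 : p < 1.
Proof. by have := p_le_half; lra. Qed.

Let sg_gt0 : 0 < sg. Proof. exact: sqrt_pq_gt0. Qed.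

Let sg2 : sg ^+ 2 = p * (1 - p). Proof. exact: sqr_sqrt_pq. Qed.

Let p0 : 0 <= p. Proof. exact: ltW. Qed.
Let p1 : p <= 1. Proof. exact: ltW. Qed.

Let gam_gt0 : 0 < gam.
Proof.
have h : 0 < 4 ^+ s * gam by apply: lt_le_trans gam_ge.
by rewrite pmulr_rgt0 ?exprn_gt0 in h.
Qed.

Lemma normr_chi (i : 'I_n) A :
  `|chi p i A| = if i \in A then (1 - p) / sg else p / sg.
Proof.
rewrite chiE; case: (i \in A); rewrite ?normrN ger0_norm // divr_ge0 ?subr_ge0 //;
  exact: ltW.
Qed.

(** Induction moves elements from [S] to [X]: [|chi_i|] is at most [(1 - p) / sg] times the
    indicator of [i] plus [p / sg], and globalness charges [2p] for the indicator. Each step costs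
    [((1 - p) * 2p + p) / sg], which is at most [4 sg] exactly when [p <= 1/2]. *)
Lemma expect_global_chi S X : [disjoint S & X] ->
  expect p (fun A => f A * (X \subset A)%:R * `|chiS p S A|)
    <= (4 * sg) ^+ #|S| * (2 * p) ^+ #|X| * gam.
Proof.
have [k] := ubnP #|S|; elim: k S X => // k IH S X /ltnSE leSk dSX.
have [->|[i iS]] := set_0Vmem S.
  rewrite cards0 expr0 mul1r; apply: le_trans (f_global X).
  by apply: le_expect => // A; rewrite chiS0 normr1 mulr1.
set S' := S :\ i; have SE : S = i |: S' by rewrite setD1K.
have iS' : i \notin S' by rewrite setD11.
have iX : i \notin X by apply: contraL iS => iX; rewrite (disjointFl dSX).
have ltS' : (#|S'| < k)%N by move: leSk; rewrite (cardsD1 i) iS.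
have dS'X : [disjoint S' & X] by apply: disjointWl dSX; rewrite subD1set.
have dS'iX : [disjoint S' & i |: X] 
  by rewrite -setI_eq0 setIUr setU_eq0 !setI_eq0 dS'X andbT disjoint_sym disjoints1.
have h1 := IH _ _ ltS' dS'X; have h2 := IH _ _ ltS' dS'iX.
apply: (@le_trans _ _ (expect p (fun A =>
   (1 - p) / sg * (f A * (i |: X \subset A)%:R * `|chiS p S' A|) +
   p / sg * (f A * (X \subset A)%:R * `|chiS p S' A|)))).
  apply: le_expect => // A; rewrite SE chiSU1 // normrM normr_chi subUset sub1set.
  set t := f A * (X \subset A)%:R * `|chiS p S' A|.
  have t0 : 0 <= t by rewrite !mulr_ge0.
  have t1 : 0 <= p / sg * t by rewrite mulr_ge0 // divr_ge0 // ltW.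
  have -> (y : R) : f A * (X \subset A)%:R * (y * `|chiS p S' A|) = y * t.
    by rewrite /t; ring.
  case: (i \in A) => /=; first by rewrite -/t lerDl.
  by rewrite mulr0 mul0r mulr0 add0r.
rewrite expectD !expectZ.
have x1_ge0 : 0 <= (1 - p) / sg by rewrite divr_ge0 ?subr_ge0 // ltW.
have x0_ge0 : 0 <= p / sg by rewrite divr_ge0 // ltW.
apply: le_trans (lerD (ler_wpM2l x1_ge0 h2) (ler_wpM2l x0_ge0 h1)) _.
rewrite SE !cardsU1 iS' iX !exprS.
set u := (4 * sg) ^+ #|S'| * (2 * p) ^+ #|X| * gam.
have u0 : 0 <= u by rewrite !mulr_ge0 ?exprn_ge0 ?mulr_ge0 // ltW.
have -> : (1 - p) / sg * ((4 * sg) ^+ #|S'| * (2 * p * (2 * p) ^+ #|X|) * gam)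
   + p / sg * ((4 * sg) ^+ #|S'| * (2 * p) ^+ #|X| * gam)
   = ((1 - p) / sg * (2 * p) + p / sg) * u by rewrite /u; ring.
have -> : 4 * sg * (4 * sg) ^+ #|S'| * (2 * p) ^+ #|X| * gam = 4 * sg * u.
  by rewrite /u; ring.
apply: ler_wpM2r => //.
have sgn : sg != 0 by rewrite gt_eqF.
rewrite -(ler_pM2r sg_gt0) -[leRHS]mulrA -expr2 sg2.
have -> : ((1 - p) / sg * (2 * p) + p / sg) * sg = (1 - p) * (2 * p) + p by field.
have := p_le_half; have := p_gt0; nra.
Qed.

(** [g] ignores the coordinates in [S], and each [|chi_i|] has mean [2 sg]. *)
Lemma expect_chi_factor S (g : {set 'I_n} -> R) :
  (forall i A, i \in S -> g (i |: A) = g A) ->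
  expect p (fun A => `|chiS p S A| * g A) = (2 * sg) ^+ #|S| * expect p g.
Proof.
move=> gS.
have := @expect_prod_factor R n p S
  (fun _ b => if b then (1 - p) / sg else p / sg) g gS.
rewrite prodr_const => E.
have -> : 2 * sg = p * ((1 - p) / sg) + (1 - p) * (p / sg).
  have sgn : sg != 0 by rewrite gt_eqF.
  by apply: (mulIf sgn); rewrite -[LHS]mulrA -expr2 sg2; field.
rewrite -E; apply: eq_expect => A; congr (_ * _); rewrite /chiS normr_prod.
by apply: eq_bigr => i _; rewrite normr_chi.
Qed.
(** Each restricted coordinate costs [M] in [hypercontractive] but gains the ratio [tau / B] of
    [level_bound] in [s - 1] factors; the gain covers the cost. After the powers of [p] cancel, what
    remains is [2s <= 2^(s-1)], which needs [s >= 4]. *)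
Lemma hypercontractive_loss :
  p * ((1 - p) / p * (2 * s%:R)) ^+ s * (16 * (p * (1 - p)) / (64 * s%:R)) ^+ s.-1 <= 1.
Proof.
have pn : p != 0 by rewrite gt_eqF.
have sn : s%:R != 0 :> R by rewrite pnatr_eq0; case: (s) s_ge4.
have -> : 16 * (p * (1 - p)) / (64 * s%:R) = p * (1 - p) / (4 * s%:R).
  by field.
have pow : (2 * s <= 2 ^ s.-1)%N.
  case: (s) s_ge4 => // s' /=; rewrite ltnS => s3.
  elim: s' s3 => // k IH; rewrite leq_eqVlt => /predU1P[<- //|k3].
  have := IH k3; rewrite expnS; lia.
have -> : p * ((1 - p) / p * (2 * s%:R)) ^+ s =
    (1 - p) * (2 * s%:R) * ((1 - p) / p * (2 * s%:R)) ^+ s.-1.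
  by case: (s) s_ge4 => // s' _ /=; rewrite exprS; field.
rewrite -[X in X <= _]mulrA -exprMn.
have -> : (1 - p) / p * (2 * s%:R) * (p * (1 - p) / (4 * s%:R)) = (1 - p) ^+ 2 / 2.
  by field; rewrite ?pn ?sn.
have X0 : 0 <= ((1 - p) ^+ 2) ^+ s.-1 by rewrite exprn_ge0 ?sqr_ge0.
have X1 : ((1 - p) ^+ 2) ^+ s.-1 <= 1.
  by rewrite -exprM exprn_ile1 ?subr_ge0 // gerBl.
have Y : 2 * s%:R / 2 ^+ s.-1 <= 1 :> R.
  by rewrite ler_pdivrMr ?exprn_gt0 // mul1r -natrM -natrX ler_nat.
rewrite expr_div_n; set X := ((1 - p) ^+ 2) ^+ s.-1 in X0 X1 *.
have -> : (1 - p) * (2 * s%:R) * (X / 2 ^+ s.-1) =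
  (1 - p) * X * (2 * s%:R / 2 ^+ s.-1) by ring.
have q0 : 0 <= 1 - p by rewrite subr_ge0.
have q1 : 1 - p <= 1 by rewrite gerBl.
have Y0 : 0 <= 2 * s%:R / 2 ^+ s.-1 :> R by rewrite divr_ge0 ?mulr_ge0 ?exprn_ge0.
apply: mulr_ile1 => //; first exact: mulr_ge0.
exact: mulr_ile1.
Qed.

(* Only the empty [S] matters in the end, but the induction on [d] passes through
   the derivatives of [f] in the directions [S]. *)
Lemma level_bound (d : nat) (S : {set 'I_n}) :
  \sum_(T : {set 'I_n} | (S \subset T) && (#|T| == #|S| + d)%N) fhat p f T ^+ 2
  <= (4 * gam) ^+ 2 * (16 * (p * (1 - p))) ^+ #|S| * (64 * s%:R) ^+ d.
Proof.
elim/ltn_ind: d S => d IH S.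
set tau := 16 * (p * (1 - p)) in IH *; set B := 64 * s%:R in IH *.
set G := (4 * gam) ^+ 2 in IH *.
have s_gt0 : (0 < s)%N by apply: leq_trans s_ge4.
have sR : 0 < s%:R :> R by rewrite ltr0n.
have tau0 : 0 < tau by rewrite !mulr_gt0 // subr_gt0.
have B0 : 0 < B by rewrite mulr_gt0.
have G0 : 0 < G by rewrite exprn_gt0 // mulr_gt0.
(* Coefficients of the level-[d] part of the derivative of [f] in the directions [S]. *)
pose c (T : {set 'I_n}) : R :=
  if [disjoint S & T] && (#|T| == d)%N then fhat p f (S :|: T) else 0.
have cd T : c T != 0 -> #|T| = d.
  by rewrite /c; case: ifP => [/andP[_ /eqP]|]; rewrite ?eqxx.
set W := (X in X <= _).
have tailE (S' : {set 'I_n}) : [disjoint S & S'] ->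
    \sum_(T : {set 'I_n}) (S' \subset T)%:R * c T ^+ 2 =
    \sum_(T : {set 'I_n} | (S :|: S' \subset T) && (#|T| == #|S| + d)%N) fhat p f T ^+ 2.
  move=> dS.
  pose F (T : {set 'I_n}) : R := if (S' \subset T) && (#|T| == #|S| + d)%N
    then fhat p f T ^+ 2 else 0.
  transitivity (\sum_(T : {set 'I_n} | [disjoint S & T]) F (S :|: T)).
    rewrite [RHS]big_mkcond; apply: eq_bigr => T _; rewrite /c /F.
    case dT: [disjoint S & T] => /=; last by rewrite expr0n mulr0.
    have -> : #|S :|: T| = (#|S| + #|T|)%N.
      by rewrite cardsU disjoint_setI0 // cards0 subn0.
    have -> : (S' \subset S :|: T) = (S' \subset T).
      apply/idP/idP => [/subsetP ST|ST]; last first.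
        exact: subset_trans ST (subsetUr _ _).
      apply/subsetP => j jS; have := ST j jS.
      by rewrite inE (disjointFl dS jS).
    rewrite eqn_add2l; case: (S' \subset T) => /=; last by rewrite mul0r.
    by case: ifP => _; rewrite mul1r ?expr0n.
  rewrite sum_disjoint_setU big_mkcondr [LHS]big_mkcond [RHS]big_mkcond.
  by apply: eq_bigr => T _; rewrite /F subUset; case: (S \subset T); case: (S' \subset T).
have WE : W = \sum_(T : {set 'I_n}) c T ^+ 2.
  transitivity (\sum_(T : {set 'I_n}) (set0 \subset T)%:R * c T ^+ 2).
    by rewrite tailE ?setU0 // -setI_eq0 setI0.
  by apply: eq_bigr => T _; rewrite sub0set mul1r.
(* Assuming that [W] exceeds the claimed bound, the induction hypothesis at [S :|: S'] can be
   restated as a bound relative to [W] itself, namely [tail_le]. *)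
rewrite leNgt; apply/negP => W_big.
have bd0 : 0 < G * tau ^+ #|S| * B ^+ d by rewrite !mulr_gt0 ?exprn_gt0.
have W0 : 0 < W by apply: lt_trans W_big.
have tail_le (S' : {set 'I_n}) :
    \sum_(T : {set 'I_n}) (S' \subset T)%:R * c T ^+ 2 <= (tau / B) ^+ #|S'| * W.
  have [->|S'n] := eqVneq S' set0.
    rewrite cards0 expr0 mul1r WE le_eqVlt; apply/orP; left; apply/eqP.
    by apply: eq_bigr => T _; rewrite sub0set mul1r.
  have tail0 : ~~ ([disjoint S & S'] && (#|S'| <= d)%N) ->
      \sum_(T : {set 'I_n}) (S' \subset T)%:R * c T ^+ 2 = 0.
    move=> h; apply: big1 => T _; case ST: (S' \subset T); last by rewrite mul0r.
    rewrite /c; case: ifP => [/andP[dT /eqP cT]|]; last by rewrite expr0n mulr0.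
    by case/negP: h; rewrite (disjointWr ST dT) -cT subset_leq_card.
  have [/andP[dS S'd]|h] := boolP ([disjoint S & S'] && (#|S'| <= d)%N); last first.
    by rewrite tail0 // mulr_ge0 ?exprn_ge0 ?divr_ge0 // ltW.
  rewrite tailE //.
  have cardSS' : #|S :|: S'| = (#|S| + #|S'|)%N.
    by rewrite cardsU disjoint_setI0 // cards0 subn0.
  have S'0 : (0 < #|S'|)%N by rewrite card_gt0.
  have := IH (d - #|S'|)%N _ (S :|: S'); rewrite cardSS' -addnA subnKC //.
  move=> /(_ _)/le_trans; apply; first by rewrite ltn_subrL S'0 (leq_trans S'0).
  have -> : G * tau ^+ (#|S| + #|S'|) * B ^+ (d - #|S'|) =
      (tau / B) ^+ #|S'| * (G * tau ^+ #|S| * B ^+ d).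
    rewrite -[in RHS](subnKC S'd) !exprD expr_div_n; field.
    by rewrite expf_neq0 // gt_eqF.
  by rewrite ler_wpM2l ?(ltW W_big) // exprn_ge0 // divr_ge0 // ltW.
pose rho := Num.sqrt ((18 * s%:R)^-1) : R.
have rho2 : rho ^+ 2 = (18 * s%:R)^-1.
  by rewrite sqr_sqrtr // invr_ge0 mulr_ge0.
have rhoE : rho ^+ 2 * (18 * s%:R) = 1.
  by rewrite rho2 mulVf // mulf_neq0 // gt_eqF.
pose u A := \sum_(T : {set 'I_n}) c T * chiS p T A.
have u_moment : expect p (fun A => (u A ^+ 2) ^+ s) <= ((36 * s%:R) ^+ d * W) ^+ s.
  (* The index type [unit] gives the scalar case. As [u] is homogeneous of degree [d], the noise
     only contributes a factor [rho ^+ d]. *)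
  have := @hypercontractive R n p p_gt0 p_lt1 s rho s_gt0 (sqrtr_ge0 _) rhoE
    p_le_half setT unit (fun _ => c).
  set M := p * _ ^+ s.
  rewrite (eq_expect _ _ _ _ (fun A => (rho ^+ 2) ^+ (d * s) * (u A ^+ 2) ^+ s)); last first.
    move=> A; rewrite (big_pred1 tt) => [|[]//].
    have -> : \sum_(T : {set 'I_n} | T \subset setT) rho ^+ #|T| * c T * chiS p T A
        = rho ^+ d * u A.
      rewrite mulr_sumr; apply: eq_big => [T|T _]; first by rewrite subsetT.
      have [->|/cd ->] := eqVneq (c T) 0; first by rewrite !(mul0r, mulr0).
      by rewrite mulrA.
    by rewrite !exprMn -!exprM; ring.
  rewrite expectZ => hyp.
  have M0 : 0 <= M.
    rewrite mulr_ge0 ?exprn_ge0 // mulr_ge0 ?mulr_ge0 //.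
      by rewrite subr_ge0.
    by rewrite invr_ge0.
  have tauB0 : 0 <= tau / B by rewrite divr_ge0 // ltW.
  (* Of the [s] factors, [s - 1] are bounded by [tail_le], which absorbs [M ^+ #|S'|]. The last
     factor is kept, so that summing over [S'] counts the subsets of each [T] and yields
     [2 ^+ d * W]. *)
  have term (S' : {set 'I_n}) : M ^+ #|S'| *
      (\sum_(v : unit) \sum_(T : {set 'I_n} | T \subset setT) (S' \subset T)%:R * c T ^+ 2) ^+ s
      <= W ^+ s.-1 * \sum_(T : {set 'I_n}) (S' \subset T)%:R * c T ^+ 2.
    rewrite (big_pred1 tt) => [|[]//].
    rewrite (eq_bigl xpredT) => [|T]; last by rewrite subsetT.
    have t_le := tail_le S'; set t := \sum_(T : {set 'I_n}) _ in t_le *.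
    have t0 : 0 <= t by apply: sumr_ge0 => T _; rewrite mulr_ge0 ?sqr_ge0.
    have -> : t ^+ s = t ^+ s.-1 * t by rewrite -exprSr prednK.
    rewrite mulrA ler_wpM2r //.
    apply: (@le_trans _ _ (M ^+ #|S'| * ((tau / B) ^+ #|S'| * W) ^+ s.-1)).
      rewrite ler_wpM2l ?exprn_ge0 // lerXn2r ?nnegrE //.
      by rewrite mulr_ge0 ?exprn_ge0 // ltW.
    rewrite [(_ * W) ^+ _]exprMn [((tau / B) ^+ _) ^+ _]exprAC mulrA -exprMn.
    rewrite ler_piMl ?exprn_ge0 ?(ltW W0) //.
    have MtauB0 : 0 <= M * (tau / B) ^+ s.-1.
      by apply: mulr_ge0 => //; apply: exprn_ge0.
    rewrite exprn_ile1 //.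
    exact: hypercontractive_loss.
  have total : \sum_(S' : {set 'I_n}) \sum_(T : {set 'I_n}) (S' \subset T)%:R * c T ^+ 2 = 2 ^+ d * W.
    rewrite exchange_big /= WE mulr_sumr; apply: eq_bigr => T _.
    rewrite -mulr_suml sum_subset_indicator.
    by have [->|/cd ->] := eqVneq (c T) 0; rewrite ?expr0n ?mulr0.
  have hyp2 : (rho ^+ 2) ^+ (d * s) * expect p (fun A => (u A ^+ 2) ^+ s) <= 2 ^+ d * W ^+ s.
    apply: le_trans hyp _; rewrite (eq_bigl xpredT) => [|T]; last by rewrite subsetT.
    apply: le_trans (ler_sum _ (fun S' _ => term S')) _.
    by rewrite -mulr_sumr total mulrCA -exprSr prednK.
  have r0 : 0 < (18 * s%:R) ^+ (d * s) :> R by rewrite exprn_gt0 // mulr_gt0.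
  have := ler_wpM2l (ltW r0) hyp2.
  rewrite mulrA -exprMn mulrC [18 * s%:R * _]mulrC rhoE expr1n mulr1.
  move/le_trans; apply.
  (* The constant 36 is 18 from [rho] times 2 from counting subsets, after the crude bound
     [2^d <= (2^d)^s]. *)
  have -> : ((36 * s%:R) ^+ d * W) ^+ s = (18 * s%:R) ^+ (d * s) * ((2 ^+ d) ^+ s * W ^+ s).
    have -> : (36 * s%:R) ^+ d = 2 ^+ d * (18 * s%:R) ^+ d :> R.
      by rewrite -exprMn; congr (_ ^+ _); ring.
    by rewrite [(_ * W) ^+ s]exprMn [(2 ^+ d * _) ^+ s]exprMn exprM; ring.
  rewrite ler_wpM2l ?(ltW r0) // ler_wpM2r ?exprn_ge0 ?(ltW W0) //.
  by rewrite ler_eXnr // exprn_ege1 // ler1n.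
(* Testing [f] against [chiS p S * u] recovers [W], because its coefficient at [S :|: T] is exactly
   [c T]. *)
have u_pair : expect p (fun A => f A * (chiS p S A * u A)) = W.
  rewrite WE (eq_expect _ _ _ _ (fun A => \sum_(T : {set 'I_n}) c T * (f A * (chiS p S A * chiS p T A)))).
    rewrite expect_sum; apply: eq_bigr => T _; rewrite expectZ /c.
    case: ifP => [/andP[dT _]|_]; last by rewrite mul0r expr0n.
    rewrite expr2; congr (_ * _); apply: eq_expect => A.
    by rewrite chiS_setU.
  by move=> A; rewrite !mulr_sumr; apply: eq_bigr => T _; ring.
pose N := Num.sqrt ((36 * s%:R) ^+ d * W).
have N2 : N ^+ 2 = (36 * s%:R) ^+ d * W.
  by rewrite sqr_sqrtr // mulr_ge0 ?exprn_ge0 ?mulr_ge0 // ltW.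
have N0 : 0 < N by rewrite sqrtr_gt0 mulr_gt0 ?exprn_gt0 ?mulr_gt0.
have W_le : W <= N * (4 * gam) * (4 * sg) ^+ #|S|.
  have uU i A : i \in S -> u (i |: A) = u A.
    move=> iS; apply: eq_bigr => T _; rewrite /c.
    case: ifP => [/andP[dT _]|_]; last by rewrite !mul0r.
    by rewrite chiS_addl // (disjointFr dT iS).
  pose g A := (u A ^+ 2 / N ^+ 2) ^+ s.
  have gU i A : i \in S -> g (i |: A) = g A by move=> iS; rewrite /g uU.
  have Eg : expect p g <= 1.
    rewrite (eq_expect _ _ _ _ (fun A => ((N ^+ 2) ^+ s)^-1 * (u A ^+ 2) ^+ s)).
      rewrite expectZ N2 mulrC ler_pdivrMr ?mul1r //.
      by rewrite exprn_gt0 // -N2 exprn_gt0.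
    by move=> A; rewrite /g expr_div_n mulrC.
  (* Cut off at [|u| = 2N]: below it, globalness of [f] bounds the pairing; above it, [f <= 1] and
     the [2s]-th moment of [u], which is independent of the coordinates in [S], take over. *)
  have point A : f A * (chiS p S A * u A) <=
      2 * N * (f A * (set0 \subset A)%:R * `|chiS p S A|)
      + 2 * N * (4 ^+ s)^-1 * (`|chiS p S A| * g A).
    have x0 : 0 <= `|u A| / N by rewrite divr_ge0 // ltW.
    have := le_cutoff_power R s _ s_gt0 x0.
    rewrite expr_div_n real_normK ?num_real // -/(g A) ler_pdivrMr // => hx.
    apply: (@le_trans _ _ (f A * (`|chiS p S A| * `|u A|))).
      by rewrite ler_wpM2l // -normrM ler_norm.
    apply: le_trans (ler_wpM2l (f_ge0 A) (ler_wpM2l (normr_ge0 _) hx)) _.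
    rewrite sub0set mulr1.
    have g0 : 0 <= g A by rewrite exprn_ge0 // divr_ge0 ?sqr_ge0.
    set y := 2 * N * (4 ^+ s)^-1 * (`|chiS p S A| * g A).
    have y0 : 0 <= y.
      apply: mulr_ge0; last by apply: mulr_ge0.
      apply: mulr_ge0; last by rewrite invr_ge0 exprn_ge0.
      by apply: mulr_ge0 => //; apply: ltW.
    have -> : f A * (`|chiS p S A| * ((2 + 2 * ((4 ^+ s)^-1 * g A)) * N)) =
       2 * N * (f A * `|chiS p S A|) + f A * y by rewrite /y; ring.
    by rewrite lerD2l ler_piMl.
  rewrite -u_pair; apply: le_trans (le_expect _ _ _ p0 p1 _ _ point) _.
  rewrite expectD !expectZ expect_chi_factor //.
  have dS0 : [disjoint S & (set0 : {set 'I_n})] by rewrite -setI_eq0 setI0.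
  have h1 := expect_global_chi _ _ dS0; rewrite cards0 expr0 mulr1 in h1.
  have h2 : (2 * sg) ^+ #|S| * expect p g <= (4 * sg) ^+ #|S|.
    have le24 : (2 * sg) ^+ #|S| <= (4 * sg) ^+ #|S|.
      rewrite lerXn2r ?nnegrE ?mulr_ge0 ?(ltW sg_gt0) //.
      by rewrite ler_wpM2r ?(ltW sg_gt0) // ler_nat.
    apply: le_trans le24; rewrite ler_piMr // exprn_ge0 // mulr_ge0 //; exact: ltW.
  (* The exponent [s] is large enough compared with [log (1 / gam)] for the excess above the cutoff
     to cost no more than the bulk. *)
  have gam4 : (4 ^+ s)^-1 <= gam.
    by rewrite -[(4 ^+ s)^-1]mul1r ler_pdivrMr ?exprn_gt0 // mulrC.
  set Q := (4 * sg) ^+ #|S| in h1 h2 *.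
  have Q0 : 0 <= Q by rewrite exprn_ge0 // mulr_ge0 // ltW.
  have -> : N * (4 * gam) * Q = 2 * N * (Q * gam) + 2 * N * gam * Q by ring.
  have N20 : 0 <= 2 * N by rewrite mulr_ge0 // ltW.
  apply: lerD; first by rewrite ler_wpM2l.
  apply: (@le_trans _ _ (2 * N * (4 ^+ s)^-1 * Q)).
    by rewrite ler_wpM2l // mulr_ge0 // invr_ge0 exprn_ge0.
  by rewrite ler_wpM2r // ler_wpM2l.
(* Since [N^2] is linear in [W], squaring and dividing by [W] gives [W <= (36 s)^d * G * tau^|S|],
   which contradicts [W_big] because [36 <= 64]. *)
have : W ^+ 2 <= (N * (4 * gam) * (4 * sg) ^+ #|S|) ^+ 2.
  by rewrite lerXn2r ?nnegrE ?(le_trans _ W_le) // ltW.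
have -> : (N * (4 * gam) * (4 * sg) ^+ #|S|) ^+ 2 = (36 * s%:R) ^+ d * W * (G * tau ^+ #|S|).
  rewrite [(_ * _ ^+ #|S|) ^+ 2]exprMn [(N * _) ^+ 2]exprMn N2 -/G -mulrA.
  congr (_ * (G * _)); rewrite exprAC; congr (_ ^+ #|S|).
  by rewrite exprMn sg2 -natrX.
rewrite expr2 [_ ^+ d * W]mulrC -[leRHS]mulrA ler_pM2l // => hW.
have : (36 * s%:R) ^+ d * (G * tau ^+ #|S|) <= G * tau ^+ #|S| * B ^+ d.
  have Gt0 : 0 <= G * tau ^+ #|S|.
    by apply: mulr_ge0; [apply: ltW | apply: exprn_ge0; apply: ltW].
  rewrite mulrC ler_wpM2l //.
  rewrite lerXn2r ?nnegrE ?mulr_ge0 ?(ltW B0) ?(ltW sR) //.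
  by rewrite ler_wpM2r ?(ltW sR) // ler_nat.
by move/(le_trans hW); rewrite leNgt W_big.
Qed.

End Level.

(** * Cross-intersecting global families *)

Section CrossIntersecting.
Variables (R : realType) (n : nat) (p : R).
Hypotheses (p_gt0 : 0 < p) (p_lt1 : p < 1).
Implicit Types (A B T : {set 'I_n}) (g : {set 'I_n} -> R).

(* The right-hand side is the density, with respect to independent copies, of the
   coupling of two copies of [mu_p] that never share an element. *)
Lemma disjoint_kernel A B :
  \sum_(T : {set 'I_n}) (- (p / (1 - p))) ^+ #|T| * (chiS p T A * chiS p T B)
  = \prod_i (1 - p / (1 - p) * (chi p i A * chi p i B)).
Proof.
rewrite (eq_bigr (fun i => - (p / (1 - p)) * (chi p i A * chi p i B) + 1)) => [|i _].
  rewrite bigA_distr; apply: eq_bigr => T _.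
  rewrite -big_mkcond /= big_split /= prodr_const big_split.
  by rewrite /chiS.
by rewrite addrC mulNr.
Qed.

(** A common element [i] contributes the factor [1 - p/(1-p) * (1-p)/p = 0] to the product. *)
Lemma disjoint_kernel_eq0 A B : A :&: B != set0 ->
  \sum_(T : {set 'I_n}) (- (p / (1 - p))) ^+ #|T| * (chiS p T A * chiS p T B) = 0.
Proof.
move=> /set0Pn[i /setIP[iA iB]]; rewrite disjoint_kernel (bigD1 i) //=.
rewrite !chiE // iA iB mulf_div -[Num.sqrt _ * _]expr2 sqr_sqrt_pq //.
have -> : 1 - p / (1 - p) * ((1 - p) * (1 - p) / (p * (1 - p))) = 0.
  by field; rewrite (gt_eqF p_gt0) subr_eq0 gt_eqF.
by rewrite mul0r.
Qed.

Lemma cross_intersecting_noise g0 g1 :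
  (forall A B, g0 A != 0 -> g1 B != 0 -> A :&: B != set0) ->
  \sum_(T : {set 'I_n}) (- (p / (1 - p))) ^+ #|T| * (fhat p g0 T * fhat p g1 T) = 0.
Proof.
move=> cross.
transitivity (\sum_(A : {set 'I_n}) \sum_(B : {set 'I_n})
   mu_pt p A * mu_pt p B * (g0 A * g1 B) *
   \sum_(T : {set 'I_n}) (- (p / (1 - p))) ^+ #|T| * (chiS p T A * chiS p T B)).
  under eq_bigr => T _.
    rewrite /fhat /expect mulr_suml mulr_sumr.
    under eq_bigr => A _ do rewrite mulr_sumr mulr_sumr.
    over.
  rewrite exchange_big; apply: eq_bigr => A _; rewrite exchange_big.
  apply: eq_bigr => B _; rewrite mulr_sumr; apply: eq_bigr => T _; ring.
apply: big1 => A _; apply: big1 => B _.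
have [->|gA] := eqVneq (g0 A) 0; first by rewrite !(mul0r, mulr0).
have [->|gB] := eqVneq (g1 B) 0; first by rewrite !(mul0r, mulr0).
by rewrite disjoint_kernel_eq0 ?mulr0 // cross.
Qed.

Lemma fhat0 g : fhat p g set0 = expect p g.
Proof. by apply: eq_expect => A; rewrite chiS0 mulr1. Qed.

Lemma sum_by_card (F : {set 'I_n} -> R) :
  \sum_(T : {set 'I_n} | T != set0) F T =
  \sum_(k < n) \sum_(T : {set 'I_n} | #|T| == k.+1) F T.
Proof.
rewrite (exchange_big_dep (fun T : {set 'I_n} => T != set0)) /=; last first.
  by move=> k T _ /eqP cT; rewrite -card_gt0 cT.
apply: eq_bigr => T T0; have cT : (#|T|.-1 < n)%N.
  rewrite prednK ?card_gt0 //; have := max_card (mem T).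
  by rewrite card_ord.
rewrite (big_pred1 (Ordinal cT)) // => k /=; rewrite -val_eqE /=.
by rewrite -(prednK (_ : 0 < #|T|)%N) ?card_gt0 // eqSS eq_sym.
Qed.

Lemma geometric_le (t : R) : 0 <= t -> t <= 1 / 64 ->
  \sum_(k < n) t ^+ k.+1 <= 1 / 63.
Proof.
move=> t0 t1.
apply: (@le_trans _ _ (\sum_(k < n) (1 / 64) ^+ k.+1)).
  by apply: ler_sum => k _; rewrite lerXn2r // nnegrE; lra.
suff: 63 * (\sum_(k < n) (1 / 64 : R) ^+ k.+1) + (1 / 64) ^+ n = 1.
  by have := exprn_ge0 n (_ : 0 <= 1 / 64 :> R); lra.
elim: n => [|k IH]; first by rewrite big_ord0 mulr0 add0r expr0.
rewrite big_ord_recr /= -[RHS]IH exprS; by field.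
Qed.

Variables (s : nat) (gam0 gam1 : R) (g0 g1 : {set 'I_n} -> R).
Hypotheses (p_le_half : p <= 1 / 2) (s_ge4 : (4 <= s)%N).
Hypothesis noise_small : p / (1 - p) * (64 * s%:R) <= 1 / 64.
Hypotheses (g0_ge0 : forall A, 0 <= g0 A) (g0_le1 : forall A, g0 A <= 1).
Hypotheses (g1_ge0 : forall A, 0 <= g1 A) (g1_le1 : forall A, g1 A <= 1).
Hypothesis g0_global : forall X : {set 'I_n},
  expect p (fun A => g0 A * (X \subset A)%:R) <= (2 * p) ^+ #|X| * gam0.
Hypothesis g1_global : forall X : {set 'I_n},
  expect p (fun A => g1 A * (X \subset A)%:R) <= (2 * p) ^+ #|X| * gam1.
Hypotheses (gam0_ge : 1 <= 4 ^+ s * gam0) (gam1_ge : 1 <= 4 ^+ s * gam1).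
Hypothesis cross : forall A B, g0 A != 0 -> g1 B != 0 -> A :&: B != set0.

(** In the noise identity the empty set contributes the product of the means, and level [k >= 1] at
    most [16 gam0 gam1 (64 q s)^k]. The geometric series gives at most [16/63 < 1/3]. *)
Lemma cross_intersecting_global :
  expect p g0 * expect p g1 <= gam0 * gam1 / 3.
Proof.
pose q := p / (1 - p); have q_small : q * (64 * s%:R) <= 1 / 64 by [].
have q0 : 0 <= q by rewrite divr_ge0 ?subr_ge0 ?ltW.
have gam_gt0 (gam : R) : 1 <= 4 ^+ s * gam -> 0 < gam.
  move=> h; have : 0 < 4 ^+ s * gam by apply: lt_le_trans h.
  by rewrite pmulr_rgt0 ?exprn_gt0.
have G0 := gam_gt0 _ gam0_ge; have G1 := gam_gt0 _ gam1_ge.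
have lev0 k : \sum_(T : {set 'I_n} | #|T| == k) fhat p g0 T ^+ 2
    <= (4 * gam0) ^+ 2 * (64 * s%:R) ^+ k.
  have := level_bound _ _ _ _ _ _ p_gt0 p_le_half g0_ge0 g0_le1 g0_global
    s_ge4 gam0_ge k set0.
  rewrite cards0 expr0 mulr1 add0n; apply: le_trans; rewrite le_eqVlt.
  by apply/orP; left; apply/eqP/eq_bigl => T; rewrite sub0set.
have lev1 k : \sum_(T : {set 'I_n} | #|T| == k) fhat p g1 T ^+ 2
    <= (4 * gam1) ^+ 2 * (64 * s%:R) ^+ k.
  have := level_bound _ _ _ _ _ _ p_gt0 p_le_half g1_ge0 g1_le1 g1_global
    s_ge4 gam1_ge k set0.
  rewrite cards0 expr0 mulr1 add0n; apply: le_trans; rewrite le_eqVlt.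
  by apply/orP; left; apply/eqP/eq_bigl => T; rewrite sub0set.
have := cross_intersecting_noise _ _ cross.
rewrite (bigD1 set0) //= cards0 expr0 mul1r !fhat0 -/q => /eqP.
rewrite addr_eq0 => /eqP ->; rewrite -sumrN sum_by_card.
have lev k : \sum_(T : {set 'I_n} | #|T| == k)
    - ((- q) ^+ #|T| * (fhat p g0 T * fhat p g1 T))
    <= 16 * gam0 * gam1 * (q * (64 * s%:R)) ^+ k.
  (* Weighted arithmetic-geometric mean: the weights [gam1 / gam0] and [gam0 / gam1] turn both level
     bounds into the same multiple of [gam0 * gam1]. *)
  apply: (@le_trans _ _ (\sum_(T : {set 'I_n} | #|T| == k)
      q ^+ k * (1 / 2 * (gam1 / gam0) * fhat p g0 T ^+ 2
        + 1 / 2 * (gam0 / gam1) * fhat p g1 T ^+ 2))).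
    apply: ler_sum => T /eqP ->.
    apply: le_trans (ler_norm _) _.
    rewrite normrN normrM normrX normrN (ger0_norm q0) ler_wpM2l ?exprn_ge0 //.
    set x := fhat p g0 T; set y := fhat p g1 T.
    have h : 0 <= (gam1 * `|x| - gam0 * `|y|) ^+ 2 / (2 * (gam0 * gam1)).
      by rewrite divr_ge0 ?sqr_ge0 // mulr_ge0 // ltW // mulr_gt0.
    rewrite -subr_ge0; apply: le_trans h _; rewrite le_eqVlt; apply/orP; left.
    rewrite normrM -[x ^+ 2]real_normK ?num_real // -[y ^+ 2]real_normK ?num_real //.
    by apply/eqP; field; rewrite !gt_eqF.
  rewrite -mulr_sumr big_split /= -!mulr_sumr.
  apply: (@le_trans _ _ (q ^+ k * (
     1 / 2 * (gam1 / gam0) * ((4 * gam0) ^+ 2 * (64 * s%:R) ^+ k) +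
     1 / 2 * (gam0 / gam1) * ((4 * gam1) ^+ 2 * (64 * s%:R) ^+ k)))).
    rewrite ler_wpM2l ?exprn_ge0 //; apply: lerD; rewrite ler_wpM2l //.
      by rewrite mulr_ge0 ?divr_ge0 // ltW.
    by rewrite mulr_ge0 ?divr_ge0 // ltW.
  rewrite le_eqVlt [(q * _) ^+ k]exprMn; apply/orP; left; apply/eqP; field.
  by rewrite !gt_eqF.
apply: le_trans (ler_sum _ (fun (k : 'I_n) _ => lev k.+1)) _.
rewrite -mulr_sumr.
have t0 : 0 <= q * (64 * s%:R) by rewrite mulr_ge0 // mulr_ge0.
have := geometric_le _ t0 q_small.
have g01 : 0 < gam0 * gam1 by rewrite mulr_gt0.
set Z := \sum_(k < n) _ => hZ.
have : 16 * (gam0 * gam1) * Z <= 16 * (gam0 * gam1) * (1 / 63).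
  by rewrite ler_wpM2l // mulr_ge0 // ltW.
rewrite mulrA; lra.
Qed.

End CrossIntersecting.

(** * Restrictions and marginals *)

Section Restriction.
Variables (R : realType) (n : nat) (p : R).
Hypotheses (p_gt0 : 0 < p) (p_lt1 : p < 1).
Implicit Types (A S T X : {set 'I_n}) (h : {set 'I_n} -> R).

Let p0 : 0 <= p. Proof. exact: ltW. Qed.
Let p1 : p <= 1. Proof. exact: ltW. Qed.

Lemma expect_restrict h X :
  expect p (fun A => h A * (X \subset A)%:R) =
  p ^+ #|X| * expect p (fun A => h (A :|: X)).
Proof.
have gX i A : i \in X -> h ((i |: A) :|: X) = h (A :|: X).
  move=> iX; congr (h _); apply/setP => j; rewrite !inE.
  by case: eqVneq => [->|//]; rewrite iX !orbT.
have := @expect_prod_factor R n p X (fun _ b => b%:R) _ gX.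
rewrite prodr_const mulr1 mulr0 addr0 => <-.
apply: eq_expect => A; case XA: (X \subset A).
  rewrite (setUidPl XA) mulr1 big1 ?mul1r // => i iX.
  by rewrite (subsetP XA).
rewrite mulr0; move/negbT: XA => /subsetPn[i iX iA].
by rewrite (bigD1 i) //= (negPf iA) !mul0r.
Qed.

(** Union bound over the elements of [S]. *)
Lemma expect_avoid_ge h S : (forall A, 0 <= h A) ->
  expect p h - \sum_(i in S) expect p (fun A => h A * (i \in A)%:R)
  <= expect p (fun A => h A * [disjoint A & S]%:R).
Proof.
move=> h0; rewrite lerBlDr -expect_sum -expectD; apply: le_expect => // A.
case dAS: [disjoint A & S]; first by rewrite mulr1 lerDl sumr_ge0 // => i _; rewrite mulr_ge0.
have : A :&: S != set0 by rewrite setI_eq0 dAS.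
case/set0Pn => i /setIP[iA iS]; rewrite mulr0 add0r (bigD1 i) //= iA mulr1.
by rewrite lerDl sumr_ge0 // => j _; rewrite mulr_ge0.
Qed.

(* Take [S] maximising the density of [h (_ :|: S)] against the penalty
   [2 ^- #|S|]. *)
Lemma exists_global_restriction h : (forall A, 0 <= h A) ->
  exists S, (forall T, expect p (fun A => h (A :|: S) * (T \subset A)%:R)
      <= (2 * p) ^+ #|T| * expect p (fun A => h (A :|: S))) /\
    2 ^+ #|S| * expect p h <= expect p (fun A => h (A :|: S)).
Proof.
move=> h0; pose mu S := expect p (fun A => h (A :|: S)).
pose S := [arg max_(X > set0) ((2 ^+ #|X|)^-1 * mu X : R)]%O.
have S_max X : (2 ^+ #|X|)^-1 * mu X <= (2 ^+ #|S|)^-1 * mu S.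
  rewrite /S; case: Order.TotalTheory.arg_maxP => //= Y _; exact.
have pow2 k : 0 < 2 ^+ k :> R by rewrite exprn_gt0.
have mu0 X : 0 <= mu X by apply: expect_ge0.
have S_le X : mu X <= 2 ^+ #|X| * ((2 ^+ #|S|)^-1 * mu S).
  by rewrite -ler_pdivrMl //.
exists S; split=> [T|].
  rewrite (expect_restrict (fun A => h (A :|: S))) exprMn [2 ^+ _ * _]mulrC -mulrA.
  rewrite ler_wpM2l ?exprn_ge0 //.
  rewrite (eq_expect _ _ _ _ (fun A => h (A :|: (T :|: S)))); last by move=> A; rewrite setUA.
  (* Maximality is used at [T :|: S], whose size is at most [#|T| + #|S|]; comparison with [set0]
     later gives the second claim. *)
  apply: le_trans (S_le _) _; rewrite mulrA ler_wpM2r //.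
  rewrite ler_pdivrMr // -exprD ler_weXn2l ?ler1n //.
  by rewrite cardsU leq_subr.
have := S_max set0; rewrite cards0 expr0 invr1 mul1r ler_pdivlMl //.
apply: le_trans; rewrite ler_wpM2l ?(ltW (pow2 _)) // le_eqVlt; apply/orP; left.
by apply/eqP; apply: eq_expect => A; rewrite setU0.
Qed.

End Restriction.

Section Marginals.
Variables (R : realType) (n : nat) (p : R) (f : {set 'I_n} -> bool).
Hypotheses (p_gt0 : 0 < p) (p_lt1 : p < 1).
Implicit Types (A S T : {set 'I_n}) (i : 'I_n).

Let sg := Num.sqrt (p * (1 - p)).
Let p0 : 0 <= p. Proof. exact: ltW. Qed.
Let p1 : p <= 1. Proof. exact: ltW. Qed.

Lemma fhat1E i : Num.sqrt (p * (1 - p)) * fhat1 p f i =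
  expect p (fun A => (f A)%:R * ((i \in A)%:R - p)).
Proof.
rewrite /fhat1 -[\sum_A _]/(expect p (fun A => (f A)%:R * chi p i A)) -expectZ.
apply: eq_expect => A; rewrite /chi; field.
by rewrite gt_eqF ?sqrt_pq_gt0.
Qed.

Lemma fhat1_le_delta i : `|fhat1 p f i| <= delta p f.
Proof. exact: le_bigmax. Qed.

Lemma delta_attained : (0 < n)%N -> exists i, delta p f = `|fhat1 p f i|.
Proof.
case: n f => // n' f' _.
by eexists; apply: (bigmax_eq_arg _ ord0) => // i _; apply: normr_ge0.
Qed.

Lemma mf_gt0 : (0 < n)%N -> (0 < mf p f)%N.
Proof.
move=> /delta_attained[i di]; rewrite card_gt0; apply/set0Pn; exists i.
rewrite inE di real_normK ?num_real //.
have := sqr_ge0 (fhat1 p f i); lra.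
Qed.

(** The coordinates are independent, and dividing by 2 keeps each exponent within reach of
    [expR_le_quadratic]. The linear term has mean zero and the quadratic one has mean at most
    [p / 2]. *)
Lemma expect_expR_signs S (e : 'I_n -> R) : (forall i, `|e i| <= 1) ->
  expect p (fun A => expR (\sum_(i in S) e i * ((i \in A)%:R - p) / 2))
  <= expR (p / 2) ^+ #|S|.
Proof.
move=> e1.
pose phi i (b : bool) := expR (e i * (b%:R - p) / 2).
have E : expect p (fun A => expR (\sum_(i in S) e i * ((i \in A)%:R - p) / 2)) =
    \prod_(i in S) (p * phi i true + (1 - p) * phi i false).
  rewrite -[RHS]mulr1 -[X in _ = _ * X](expect1 _ n p) -(expect_prod_factor _ _ p S phi) //.
  by apply: eq_expect => A; rewrite mulr1 expR_sum.
rewrite {}E -prodr_const.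
apply: ler_prod => i _; rewrite addr_ge0 ?mulr_ge0 ?expR_ge0 ?subr_ge0 //=.
have ei := e1 i; have e2 : e i ^+ 2 <= 1.
  by rewrite -real_normK ?num_real // exprn_ile1.
move: ei; rewrite ler_norml => /andP[eN eP].
have P0 := p_gt0; have P1 := p_lt1.
have y1 : e i * (1 - p) / 2 <= 1 / 2 by nra.
have y0 : e i * (0 - p) / 2 <= 1 / 2 by nra.
have h1 := ler_wpM2l p0 (expR_le_quadratic _ _ y1).
have q0 : 0 <= 1 - p by lra.
have h0 := ler_wpM2l q0 (expR_le_quadratic _ _ y0).
apply: le_trans (lerD h1 h0) _.
apply: le_trans (expR_ge1Dx _).
have -> : p * (1 + e i * (1 - p) / 2 + 2 * (e i * (1 - p) / 2) ^+ 2) +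
  (1 - p) * (1 + e i * (0 - p) / 2 + 2 * (e i * (0 - p) / 2) ^+ 2) =
  1 + e i ^+ 2 * (p * (1 - p)) / 2 by field.
have : e i ^+ 2 * (p * (1 - p)) <= 1 * p.
  by apply: ler_pM; rewrite ?sqr_ge0 ?mulr_ge0 // ger_pMr; lra.
lra.
Qed.

Lemma marginal_le (L : R) (mu := mu_p p f) : 0 <= L -> expR (- L) <= mu ->
  (0 < mf p f)%N -> 5000 * L <= p * (mf p f)%:R ->
  forall i, expect p (fun A => (f A)%:R * (i \in A)%:R) <= 3 * p * mu.
Proof.
move=> L0 mu_ge m_gt0 Lm j.
set m := (mf p f)%:R in Lm.
have m0 : 0 < m :> R by rewrite ltr0n.
have mu0 : 0 < mu by apply: lt_le_trans mu_ge; apply: expR_gt0.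
pose S := [set i : 'I_n | delta p f ^+ 2 / 2 <= fhat1 p f i ^+ 2].
have mS : m = #|S|%:R by [].
have sg0 : 0 < sg by rewrite sqrt_pq_gt0.
pose e i := Num.sg (fhat1 p f i).
have e1 i : `|e i| <= 1 by rewrite normr_sg; case: (_ != 0).
have d0 : 0 <= delta p f by apply: le_trans (fhat1_le_delta j).
pose G A := \sum_(i in S) e i * ((i \in A)%:R - p) / 2.
have EG : expect p (fun A => expR (G A)) <= expR (p / 2 * m).
  by rewrite mS expRM_natr; apply: expect_expR_signs.
have EfG : expect p (fun A => (f A)%:R * G A) = sg * (\sum_(i in S) `|fhat1 p f i|) / 2.
  rewrite (eq_expect _ _ _ _ (fun A => \sum_(i in S)
      e i / 2 * ((f A)%:R * ((i \in A)%:R - p)))); last first.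
    by move=> A; rewrite mulr_sumr; apply: eq_bigr => i _; ring.
  rewrite expect_sum mulr_sumr mulr_suml; apply: eq_bigr => i _.
  by rewrite expectZ -fhat1E -/sg normrEsg /e; ring.
(* The tangent to the exponential at [a] gives [expR a * (1 + G - a) <= expR G]. This [a] makes
   [expR (p / 2 * m) = expR a * expR (- L) <= expR a * mu], so averaging over [f] leaves [E[f G] <=
   a * mu]. *)
pose a := p / 2 * m + L.
have tangent : expR a * ((1 - a) * mu + expect p (fun A => (f A)%:R * G A)) <= expR (p / 2 * m).
  apply: le_trans EG.
  rewrite mulrDr /mu /mu_p -[\sum_A _]/(expect p (fun A => (f A)%:R)) mulrA -!expectZ -expectD.
  apply: le_expect => // A; case: (f A); last by rewrite !(mulr0, mul0r) addr0 expR_ge0.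
  rewrite mulr1 mul1r -mulrDr.
  have -> : expR (G A) = expR a * expR (G A - a).
    by rewrite -expRD; congr expR; ring.
  rewrite ler_wpM2l ?expR_ge0 //.
  by apply: le_trans (expR_ge1Dx _); lra.
have {}tangent : (1 - a) * mu + expect p (fun A => (f A)%:R * G A) <= mu.
  apply: le_trans mu_ge; rewrite -(ler_pM2l (expR_gt0 a)); apply: le_trans tangent _.
  by rewrite -expRD ler_expR /a; lra.
have pm0 : 0 <= p * m by rewrite mulr_ge0 // ltW.
have hS : sg * (\sum_(i in S) `|fhat1 p f i|) <= p * m * (1 + 1 / 2500) * mu.
  have : a * mu <= (p / 2 * m + p * m / 5000) * mu.
    by rewrite ler_wpM2r ?(ltW mu0) // lerD2l; lra.
  move: tangent; rewrite EfG; lra.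
(* The rational [2/3] replaces [1 / sqrt 2], as [4/9 <= 1/2]. *)
have dS : m * (2 / 3 * delta p f) <= \sum_(i in S) `|fhat1 p f i|.
  rewrite mS mulr_natl -sumr_const; apply: ler_sum => i; rewrite inE => di.
  have d23 : 0 <= 2 / 3 * delta p f by lra.
  rewrite -(ler_pXn2r (ltn0Sn 1)) ?nnegrE // real_normK ?num_real //.
  apply: le_trans di; have := sqr_ge0 (delta p f); rewrite exprMn; lra.
have hd : sg * delta p f <= (3 / 2 * (1 + 1 / 2500)) * (p * mu).
  have : sg * (m * (2 / 3 * delta p f)) <= p * m * (1 + 1 / 2500) * mu.
    by apply: le_trans hS; rewrite ler_wpM2l // ltW.
  have -> : sg * (m * (2 / 3 * delta p f)) = m * (2 / 3 * (sg * delta p f)) by ring.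
  have -> : p * m * (1 + 1 / 2500) * mu = m * ((1 + 1 / 2500) * (p * mu)) by ring.
  by rewrite ler_pM2l //; lra.
have Ej : expect p (fun A => (f A)%:R * (j \in A)%:R) = p * mu + sg * fhat1 p f j.
  rewrite fhat1E /mu /mu_p -[\sum_A _]/(expect p (fun A => (f A)%:R)) -expectZ -expectD.
  by apply: eq_expect => A; ring.
have fj : sg * fhat1 p f j <= sg * delta p f.
  by rewrite ler_wpM2l ?(ltW sg0) // (le_trans (ler_norm _)) // fhat1_le_delta.
have pmu : 0 <= p * mu by rewrite mulr_ge0 // ltW.
rewrite Ej; lra.
Qed.

End Marginals.

Lemma expR_half_le2 (R : realType) : expR (1 / 2) <= 2 :> R.
Proof. by apply: le_trans (expR_le_quadratic _ _ _) _; lra. Qed.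

Lemma expR_le_pow4 (R : realType) (k : nat) : expR k%:R <= 4 ^+ k :> R.
Proof.
rewrite -[k%:R]mulr1 expRM_natl lerXn2r ?nnegrE ?expR_ge0 //.
have -> : 1 = 1 / 2 + 1 / 2 :> R by field.
have := expR_half_le2 R; have := expR_ge0 (1 / 2 : R); rewrite expRD; nra.
Qed.

(** Used to bound the size of the restricted sets: [2^k <= expR L], and [expR (1/2) <= 2]. *)
Lemma pow2_bound (R : realType) (k : nat) (L x : R) :
  expR (- L) <= x -> 2 ^+ k * x <= 1 -> k%:R <= 2 * L.
Proof.
move=> xL kx; have : expR (k%:R * (1 / 2)) <= expR L.
  rewrite expRM_natl; apply: (@le_trans _ _ (2 ^+ k)).
    by rewrite lerXn2r ?nnegrE ?expR_ge0 // expR_half_le2.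
  have h : 2 ^+ k * expR (- L) <= 1.
    by apply: le_trans kx; rewrite ler_wpM2l // exprn_ge0.
  have := ler_wpM2r (expR_ge0 L) h.
  by rewrite mul1r -mulrA [expR (- L) * _]mulrC expRxMexpNx_1 mulr1.
rewrite ler_expR; lra.
Qed.

(** * Contradiction for a large intersecting family with small marginals *)

Section SmallMarginals.
Variables (R : realType) (n : nat) (p L : R) (f : {set 'I_n} -> bool).
Implicit Types (A S T X : {set 'I_n}).
Let mu := mu_p p f.
Hypotheses (p_gt0 : 0 < p) (pL : p * L = 1 / 10000) (L_gt2 : 2 < L).
Hypothesis mu_gt : 32 * expR (- L) < mu.
Hypothesis f_int : intersecting f.
Hypothesis marginals : forall i,
  expect p (fun A => (f A)%:R * (i \in A)%:R) <= 3 * p * mu.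

Lemma intersecting_small_marginals_absurd : False.
Proof.
have := p_gt0; have := pL; have := L_gt2; have := mu_gt => mu_big L2 pLE pp.
have L0 : 0 < L by lra.
have p_half : p <= 1 / 2 by nra.
have p_lt1 : p < 1 by lra.
have p0 : 0 <= p by lra.
have p1 : p <= 1 by lra.
have eL0 := expR_gt0 (- L).
have mu0 : 0 < mu by lra.
have le1 (h : {set 'I_n} -> bool) : expect p (fun A => (h A)%:R) <= 1.
  by rewrite -[leRHS](expect1 R n p); apply: le_expect => // A; case: (h A).
have f0 A : 0 <= (f A)%:R :> R by [].
have muE : expect p (fun A => (f A)%:R) = mu by [].
have [S0 [glob0 big0]] := exists_global_restriction R n p pp p_lt1 _ f0.
rewrite muE in big0.
pose gam0 := expect p (fun A => (f (A :|: S0))%:R); rewrite -/gam0 in glob0 big0.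
have S0L : #|S0|%:R <= 2 * L.
  apply: (@pow2_bound _ _ _ mu); first by lra.
  exact: le_trans big0 (le1 (fun A => f (A :|: S0))).
have gam0_ge : mu <= gam0.
  by apply: le_trans big0; rewrite ler_peMl ?(ltW mu0) // exprn_ege1 // ler1n.
have [f' f'E] : exists f' : {set 'I_n} -> bool,
    forall A, f' A = f A && [disjoint A & S0] by eexists.
have f'R A : (f' A)%:R = (f A)%:R * [disjoint A & S0]%:R :> R.
  by rewrite f'E; case: (f A); rewrite ?mul1r ?mul0r.
pose mu' := expect p (fun A => (f' A)%:R).
(* Avoiding [S0] loses at most [|S0| * 3p * mu <= 6 p L mu], a tiny fraction of [mu]. *)
have mu'_ge : mu / 2 <= mu'.
  have := expect_avoid_ge R n p pp p_lt1 (fun A => (f A)%:R) S0 f0.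
  rewrite muE -(eq_expect _ _ _ _ _ f'R) -/mu'; apply: le_trans.
  have : \sum_(i in S0) expect p (fun A => (f A)%:R * (i \in A)%:R)
      <= \sum_(i in S0) 3 * p * mu by apply: ler_sum => i _; apply: marginals.
  rewrite sumr_const -[_ *+ #|S0|]mulr_natl => hS.
  have : #|S0|%:R * (3 * p * mu) <= 2 * L * (3 * p * mu).
    by rewrite ler_wpM2r // !mulr_ge0 // ltW.
  have -> : 2 * L * (3 * p * mu) = 6 * (p * L) * mu by ring.
  rewrite pLE; lra.
have f'0 A : 0 <= (f' A)%:R :> R by [].
have [S1 [glob1 big1]] := exists_global_restriction R n p pp p_lt1 _ f'0.
rewrite -/mu' in big1.
pose gam1 := expect p (fun A => (f' (A :|: S1))%:R); rewrite -/gam1 in glob1 big1.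
have S1L : #|S1|%:R <= 2 * L.
  apply: (@pow2_bound _ _ _ mu'); first by lra.
  exact: le_trans big1 (le1 (fun A => f' (A :|: S1))).
have gam1_ge : mu' <= gam1.
  by apply: le_trans big1; rewrite ler_peMl ?exprn_ege1 ?ler1n //; lra.
pose g0 A : R := (f (A :|: S0))%:R * [disjoint A & S1]%:R.
pose g1 A : R := (f' (A :|: S1))%:R.
have g0_bound : gam0 / 2 <= expect p g0.
  have fS0 A : 0 <= (f (A :|: S0))%:R :> R by [].
  have := expect_avoid_ge R n p pp p_lt1 _ S1 fS0.
  rewrite -/gam0 -/g0; apply: le_trans.
  have : \sum_(i in S1) expect p (fun A => (f (A :|: S0))%:R * (i \in A)%:R)
      <= \sum_(i in S1) 2 * p * gam0.
    apply: ler_sum => i _; have := glob0 [set i]; rewrite cards1 expr1.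
    by rewrite (eq_expect _ _ _ _ (fun A => (f (A :|: S0))%:R * (i \in A)%:R)) // => A;
      rewrite sub1set.
  rewrite sumr_const -[_ *+ #|S1|]mulr_natl => hS.
  have : #|S1|%:R * (2 * p * gam0) <= 2 * L * (2 * p * gam0).
    rewrite ler_wpM2r // !mulr_ge0 //; lra.
  have -> : 2 * L * (2 * p * gam0) = 4 * (p * L) * gam0 by ring.
  rewrite pLE; lra.
(* This choice gives [L <= s], hence [expR L <= 4^s]; also [s >= 4] and [s <= 2L], both because
   [L > 2]. *)
pose s := (Num.truncn L).+2.
have sL : L <= s%:R.
  by have := truncnS_gt L; rewrite /s -natr1; lra.
have Ls : s%:R <= L + 2.
  have : (Num.truncn L)%:R <= L by rewrite truncn_le ltW.
  by rewrite /s -!natr1; lra.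
have s_ge4 : (4 <= s)%N.
  by rewrite /s !ltnS truncn_ge_nat ?(ltW L0) // ltW.
have four (gam : R) : expR (- L) <= gam -> 1 <= 4 ^+ s * gam.
  move=> hg; rewrite -[leLHS](expRxMexpNx_1 L); apply: ler_pM; rewrite ?expR_ge0 //.
  by apply: le_trans (expR_le_pow4 _ _); rewrite ler_expR.
(* The constant in the exponent enters here: [128 p L = 0.0128], below [(1 - p) / 64]. *)
have noise : p / (1 - p) * (64 * s%:R) <= 1 / 64.
  have q1 : 0 < 1 - p by lra.
  rewrite mulrAC ler_pdivrMr //.
  have : p * (64 * s%:R) <= p * (64 * (2 * L)).
    by rewrite ler_wpM2l // ler_wpM2l //; lra.
  have -> : p * (64 * (2 * L)) = 128 * (p * L) by ring.
  rewrite pLE; nra.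
(* A common element of [A :|: S0] and [B :|: S1] cannot lie in [S0], which [B :|: S1] avoids, nor in
   both [A] and [S1], which are disjoint. It therefore lies in [A :&: B]. *)
have cross A B : g0 A != 0 -> g1 B != 0 -> A :&: B != set0.
  rewrite /g0 /g1 f'E mulf_eq0 !pnatr_eq0 !eqb0 !negbK => /norP[]; rewrite !negbK.
  move=> fA dA /andP[fB dB]; have := f_int _ _ fA fB.
  move=> /set0Pn[i]; rewrite !inE => /andP[/orP[iA|iS0] /orP[iB|iS1]].
  - by apply/set0Pn; exists i; rewrite inE iA.
  - by rewrite (disjointFr dA iA) in iS1.
  - by have := disjointFl dB iS0; rewrite inE iB.
  - by have := disjointFl dB iS0; rewrite inE iS1 orbT.
have := @cross_intersecting_global R n p pp p_lt1 s gam0 gam1 g0 g1 p_half s_ge4 noise.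
have g0_range A : 0 <= g0 A <= 1.
  by rewrite /g0; case: (f _); case: [disjoint _ & _]; rewrite !(mulr0, mul0r, mul1r) ?lexx ?ler01.
have g1_range A : 0 <= g1 A <= 1.
  by rewrite /g1; case: (f' _); rewrite ?lexx ?ler01.
have g0_global X : expect p (fun A => g0 A * (X \subset A)%:R) <= (2 * p) ^+ #|X| * gam0.
  apply: le_trans (glob0 X); apply: le_expect => // A; rewrite ler_wpM2r // /g0.
  by case: [disjoint _ & _]; rewrite ?mulr1 ?mulr0.
move=> /(_ (fun A => proj1 (andP (g0_range A))) (fun A => proj2 (andP (g0_range A)))).
move=> /(_ (fun A => proj1 (andP (g1_range A))) (fun A => proj2 (andP (g1_range A)))).
move=> /(_ g0_global glob1 (four _ _) (four _ _) cross).
have e0 : expR (- L) <= gam0 by lra.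
have e1 : expR (- L) <= gam1 by lra.
move=> /(_ e0 e1); rewrite -/gam1.
have G0 : 0 < gam0 by lra.
have G1 : 0 < gam1 by lra.
(* The mean of [g1] is [gam1] itself and that of [g0] at least [gam0 / 2], so the product is too
   large for the bound [gam0 * gam1 / 3]. *)
have : gam0 / 2 * gam1 <= expect p g0 * gam1 by rewrite ler_wpM2r // ltW.
have := mulr_gt0 G0 G1; lra.
Qed.

End SmallMarginals.

Theorem mainTheorem14 (R : realType) (n : nat) (p : R)
  (f : {set 'I_n} -> bool) :
  0 < p ->
  intersecting f ->
  1 / Num.sqrt ((mf p f)%:R) <= p -> p <= 1 / 2 ->
  mu_p p f <= 32 * expR (- (1 / 10000) / p).
Proof.
move=> p_gt0 f_int m_le p_half; have p_lt1 : p < 1 by lra.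
have p0 : 0 <= p by exact: ltW.
rewrite leNgt; apply/negP; set L := 1 / 10000 / p.
have -> : - (1 / 10000) / p = - L by rewrite mulNr.
move=> mu_gt; have eL0 := expR_gt0 (- L).
have pL : p * L = 1 / 10000 by rewrite /L mulrC divfK // gt_eqF.
have L0 : 0 < L by rewrite divr_gt0 //; lra.
(* For [n = 0] the hypothesis on [mf] says nothing, since [1 / 0 = 0] by convention; but the only
   set is then empty, so an intersecting [f] vanishes. *)
have n_gt0 : (0 < n)%N.
  case: n f f_int m_le mu_gt => // f' f_int _ mu_gt.
  have f0 A : f' A = false.
    apply/negP => fA; have := f_int _ _ fA fA.
    by case/set0Pn => [[]].
  by move: mu_gt; rewrite /mu_p big1 => [|A _]; [lra | rewrite f0 mulr0].
have m_gt0 := mf_gt0 R n p f n_gt0.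
have mu_le1 : mu_p p f <= 1.
  rewrite -[leRHS](expect1 R n p); apply: le_expect => // [|A]; first exact: ltW.
  by case: (f A).
(* The factor 32 disposes of [L <= 2]: then [expR L <= 16], so [32 * expR (- L) >= 2] exceeds the
   total measure. *)
have L_gt2 : 2 < L.
  rewrite ltNge; apply/negP => L2.
  have : expR L <= 16.
    apply: (@le_trans _ _ (expR 2%:R)); first by rewrite ler_expR.
    by apply: le_trans (expR_le_pow4 R 2) _; rewrite -natrX.
  have := expRxMexpNx_1 L; nra.
have pm : 1 <= p ^+ 2 * (mf p f)%:R.
  have m0 : 0 < (mf p f)%:R :> R by rewrite ltr0n.
  have r0 : 0 < Num.sqrt ((mf p f)%:R : R) by rewrite sqrtr_gt0.
  move: m_le; rewrite ler_pdivrMr // => h.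
  have : 1 <= (p * Num.sqrt ((mf p f)%:R)) ^+ 2 by rewrite exprn_ege1.
  by rewrite exprMn sqr_sqrtr ?(ltW m0).
apply: (@intersecting_small_marginals_absurd R n p L f) => //.
apply: (@marginal_le R n p f p_gt0 p_lt1 L) => //.
- exact: ltW.
- lra.
(* After multiplication by [p] the goal follows from [1/2 <= 1 <= p^2 * mf p f]. *)
- rewrite -(ler_pM2l p_gt0); move: pm pL; lra.
Qed.
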